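(* Let $(W,S)$ be the Coxeter group of type $D_n$ ($n\ge 4$) with $S=\{u,s_1,\dots,s_{n-1}\}$, let $S'=\{s_1,\dots,s_{n-1}\}$, let $p$ be a prime, and let $K\in E$, $L\in F$. If $p\neq 2$ then $d_{KL}=1$ if and only if $c_K$ and $c_L$ have conjugate $p$-regular parts (conjugate in $W$). If $p=2$ and $n$ is even then $F=\{S\}$ and $d_{KS}=1$ for all $K\in E$. If $p=2$ and $n$ is odd (and $E$ is chosen to contain $S'$) then $F=\{S',S\}$ and $d_{KL}=1$ if and only if either $L=S$ and $K\neq S'$, or $L=S'$ and $K=S'$.
   Context: $W$ is realized as the index-2 subgroup, generated by $S$, of the group of all permutations of $\{\pm1,\dots,\pm n\}$ commuting with $i\mapsto -i$, where $s_i=(i,i+1)(-i,-i-1)$ for $1\le i\le n-1$ and $u=(-1,2)(1,-2)$. For $J\subseteq S$, $W_J=\langle J\rangle$ and $c_J$ is a Coxeter element of $W_J$ (the product of the elements of $J$ in some order). $E$ is a set of representatives of the $W$-conjugacy classes of subsets of $S$. For $J,K\subseteq S$, $\beta_{JK}$ is the number of fixed points of $W_K$ on the coset space $W/W_J$; $M^c(W)=(\beta_{JK})_{J,K\in E}$ is the parabolic table of marks. For a prime $p$, $F\subseteq E$ is the set of $J\in E$ whose row of $M^c(W)$ is non-zero modulo $p$ (equivalently, $p\nmid [N_W(W_J):W_J]$). For $K\in E$, $L\in F$, $d_{KL}=1$ if columns $K$ and $L$ of $M^c(W)$ are equal modulo $p$, and $d_{KL}=0$ otherwise; $D=(d_{KL})$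 is the decomposition matrix of the descent algebra $\Sigma_W$ modulo $p$. The $p$-regular part of $w\in W$ is the element $w'$ in the unique factorization $w=w'w''=w''w'$ with $w'$ of order prime to $p$ and $w''$ of $p$-power order. *)

(* Defs.v *)
From mathcomp Require Import all_boot all_fingroup all_solvable.

Set Implicit Arguments.
Unset Strict Implicit.
Unset Printing Implicit Defensive.

Local Open Scope group_scope.

(* The pair (i, b) : 'I_n * bool stands for (-1)^b * (i + 1), so that this type
   is {+-1, ..., +-n} and i |-> -i flips the boolean. *)
Definition signed_pt (n : nat) : finType := ('I_n * bool)%type.

Definition signed_perm (n : nat) : finGroupType := {perm signed_pt n}.

(* (i, j)(-i, -j) *)
Definition pos_swap (n : nat) (i j : 'I_n) : signed_perm n :=
  tperm ((i, false) : signed_pt n) (j, false) *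
  tperm ((i, true) : signed_pt n) (j, true).

(* (-i, j)(i, -j) *)
Definition neg_swap (n : nat) (i j : 'I_n) : signed_perm n :=
  tperm ((i, true) : signed_pt n) (j, false) *
  tperm ((i, false) : signed_pt n) (j, true).

(* S' = {s_1, ..., s_(n-1)}; with 0-based ordinals, s_(i+1) swaps i and i + 1. *)
Definition gensA (n : nat) : {set signed_perm n} :=
  [set pos_swap ij.1 ij.2 | ij : 'I_n * 'I_n & ij.2 == ij.1.+1 :> nat].

(* S = {u} together with S'; the comprehension below is the singleton {u} as
   soon as n >= 2. *)
Definition gensD (n : nat) : {set signed_perm n} :=
  [set neg_swap ij.1 ij.2 | ij : 'I_n * 'I_n &
     (ij.1 == 0%N :> nat) && (ij.2 == 1%N :> nat)]
  :|: gensA n.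

Definition weylD (n : nat) : {group signed_perm n} := <<gensD n>>%G.

Definition is_coxeter_elt (gT : finGroupType) (J : {set gT}) (c : gT) : Prop :=
  exists2 s : seq gT, perm_eq s (enum J) & c = \prod_(t <- s) t.

Definition is_subset_reps (n : nat) (E : {set {set signed_perm n}}) : bool :=
  is_transversal E
    (equivalence_partition (fun J K => K \in J :^: weylD n)
       (powerset (gensD n)))
    (powerset (gensD n)).

(* Permutations compose from left to right in the library, hence W / W_J is the
   set of right cosets, on which W acts by right multiplication. *)
Definition mark (n : nat) (J K : {set signed_perm n}) : nat :=
  #|'Fix_(rcosets <<J>> (weylD n) | 'Rs)(<<K>>)|.

Definition nonzero_rows (n p : nat) (E : {set {set signed_perm n}}) :
    {set {set signed_perm n}} :=
  [set J in E | [exists K in E, mark J K != 0%N %[mod p]]].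

Definition decomp (n p : nat) (E : {set {set signed_perm n}})
    (K L : {set signed_perm n}) : nat :=
  if [forall J in E, mark J K == mark J L %[mod p]] then 1%N else 0%N.

(* Main.v *)
Require Import Defs.
From mathcomp Require Import all_boot all_order all_algebra all_fingroup all_solvable.
From mathcomp Require Import zify ring.

Set Implicit Arguments.
Unset Strict Implicit.
Unset Printing Implicit Defensive.

Import Order.TTheory GRing.Theory Num.Theory.

Local Open Scope group_scope.

(* Odd functions on the signed points play the role of vectors. A standard
   parabolic subgroup is the stabilizer in W of a dominant vector, and a vector
   fixed by a Coxeter element c_K is fixed by W_K. Hence a coset of W_J is fixed
   by W_K iff it is fixed by c_K, so the marks mod p only depend on the p-regular
   part of c_K. Elements of W all of whose cycles are positive, except possibly two
   negative cycles one of which has length 1, are exactly the conjugates of Coxeter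
   elements of parabolic subgroups, and two of them with the same fixed vectors are
   conjugate.
   For p odd, choose K^ in E with c_K^ having the p-regular part of c_K up to
   conjugacy and W_K^ as large as possible. If p divided [N(W_K^) : W_K^], an
   element of the normalizer commuting with c_K^ would permute p positive cycles
   cyclically, and these could be merged into one by modifying only the p-part of
   c_K^, contradicting maximality. So K^ is in F; if columns K and L agree mod p,
   then the diagonal marks of L and K^ show that W_L and W_K^ embed in conjugates
   of each other, so that c_L and c_K^ are conjugate.
   For p = 2, changing the sign of an even set of coordinates normalizes W_J
   without belonging to it, unless J = S or (for n odd) W_J is conjugate to W_S',
   which makes the other rows even. *)

(** * Signed points, vectors and reflections *)

(** Two devices keep the argument elementary. Membership in W is tested by parity: a permutation of
    the 2n signed points that commutes with the sign lies in W iff it is even. And the parabolic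
    closure of an element g is encoded by one integer vector, [cycle_vec g], generic among the
    vectors fixed by g, so that an inclusion between parabolic subgroups becomes the question
    whether one element fixes one vector. The obstacle is that W has index 2 among all signed
    permutations, so elements with the same signed cycle type need not be conjugate in W. Comparing
    fixed vectors instead of cycle types removes it. A conjugator between elements without negative
    cycles can be chosen to fix a nowhere zero vector, which forces it to be even; when negative
    cycles occur, the one of length 1 provides a sign change by which an odd conjugator is
    corrected. Oddness of p enters twice in the merging: the p cycles stay distinct even up to sign,
    and the new p-part has odd order, hence is even and stays in W. *)

Section SignedPoints.

Variable n : nat.
Local Notation pt := (signed_pt n).
Local Notation sperm := (signed_perm n).
Implicit Types (a b x y : pt) (f v : pt -> int) (g h w s t : sperm).

Definition opp_pt a : pt := (a.1, ~~ a.2).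

Lemma opp_ptK : involutive opp_pt.
Proof. by case=> i b; rewrite /opp_pt /= negbK. Qed.

Lemma opp_pt_neq a : opp_pt a != a.
Proof. by case: a => i []; rewrite /opp_pt eqE /= eqxx. Qed.

Lemma opp_pt_eq a b : (opp_pt a == opp_pt b) = (a == b).
Proof. exact: (inj_eq (inv_inj opp_ptK)). Qed.

Definition opp_perm : sperm := perm (inv_inj opp_ptK).

Lemma opp_permE a : opp_perm a = opp_pt a.
Proof. exact: permE. Qed.

Lemma cent_oppP w :
  reflect (forall a, w (opp_pt a) = opp_pt (w a)) (w \in 'C[opp_perm]).
Proof.
apply: (iffP cent1P) => [cw a | cw].
  by have /permP/(_ a) := cw; rewrite !permM !opp_permE => ->.
by apply/permP => a; rewrite !permM !opp_permE cw.
Qed.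

Definition odd_fun f := forall a, f (opp_pt a) = (- f a)%R.

Definition fixes f w := [forall a, f (w a) == f a].

Lemma fixesP f w : reflect (forall a, f (w a) = f a) (fixes f w).
Proof. exact: 'forall_eqP. Qed.

Lemma fixes1 f : fixes f 1.
Proof. by apply/fixesP => a; rewrite perm1. Qed.

Lemma fixesM f w t : fixes f w -> fixes f t -> fixes f (w * t).
Proof. by move=> /fixesP fw /fixesP ft; apply/fixesP => a; rewrite permM ft fw. Qed.

Lemma fixer_group_set f : group_set [set w | fixes f w].
Proof.
apply/group_setP; split=> [|w t]; first by rewrite inE fixes1.
by rewrite !inE; apply: fixesM.
Qed.
Canonical fixer f := Group (fixer_group_set f).

Lemma fixesV f w : fixes f w -> fixes f w^-1.
Proof. by have := @groupVr _ (fixer f) w; rewrite !inE. Qed.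

Lemma fixesX f w k : fixes f w -> fixes f (w ^+ k).
Proof. by have := @groupX _ (fixer f) w k; rewrite !inE. Qed.

Lemma fixes_gen f (A : {set sperm}) :
  {in A, forall s, fixes f s} -> {in <<A>>, forall w, fixes f w}.
Proof.
move=> fA w; have /subsetP/(_ w) : <<A>> \subset fixer f.
  by rewrite gen_subG; apply/subsetP => s /fA; rewrite inE.
by move=> sub /sub; rewrite inE.
Qed.

Lemma fixes_conj f w t : fixes f (w ^ t) = fixes (f \o t) w.
Proof.
apply/fixesP/fixesP => fw a /=; last first.
  by have /= := fw (t^-1 a); rewrite permKV conjgE !permM.
by have := fw (t a); rewrite permJ.
Qed.

Lemma odd_fun_comp f w : odd_fun f -> w \in 'C[opp_perm] -> odd_fun (f \o w).
Proof. by move=> of_f /cent_oppP cw a /=; rewrite cw of_f. Qed.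

Definition refl a b : sperm := tperm a b * tperm (opp_pt a) (opp_pt b).

(* [refl a b] is the simple reflection of the root e_b - e_a, where e_(-i) = - e_i. *)
Definition simple a b :=
  ~~ b.2 && (if a.2 then (a.1 == 0%N :> nat) && (b.1 == 1%N :> nat)
             else b.1 == a.1.+1 :> nat).

Lemma simple_neq a b : simple a b -> a.1 != b.1.
Proof.
case/andP=> _; rewrite -(inj_eq val_inj) /=.
by case: (a.2) => [/andP[/eqP-> /eqP->] | /eqP->] //; rewrite ltn_eqF.
Qed.

Lemma gensDP s :
  reflect (exists a b, simple a b /\ s = refl a b) (s \in gensD n).
Proof.
apply: (iffP setUP) => [[] /imsetP[[i j]] | [[i c] [[j d] [sij ->]]]].
- by rewrite inE /= => ij ->; exists (i, true), (j, false).
- by rewrite inE /= => ij ->; exists (i, false), (j, false).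
move: sij; rewrite /simple /=; case: d => //; case: c => /= sij.
  by left; apply/imsetP; exists (i, j); rewrite ?inE.
by right; apply/imsetP; exists (i, j); rewrite ?inE.
Qed.

Lemma gensAP s :
  reflect (exists a b, [/\ simple a b, ~~ a.2 & s = refl a b]) (s \in gensA n).
Proof.
apply: (iffP imsetP) => [[[i j]] | [[i c] [[j d] [sij /= c0 ->]]]].
  by rewrite inE /= => ij ->; exists (i, false), (j, false).
by move: sij; rewrite /simple /=; case: d c c0 => [] [] // _ sij; exists (i, j); rewrite ?inE.
Qed.

Lemma gensA_sub : gensA n \subset gensD n.
Proof. exact: subsetUr. Qed.

Lemma refl_ends a b : a.1 != b.1 ->
  [/\ a != b, opp_pt a != b, a != opp_pt b & opp_pt a != opp_pt b].
Proof.
move=> neq; split; apply: contra neq; rewrite ?opp_pt_eq; try by move/eqP->.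
  by move/eqP <-.
Qed.

Lemma reflE a b x : a.1 != b.1 ->
  refl a b x = if x == a then b else if x == b then a else
               if x == opp_pt a then opp_pt b else
               if x == opp_pt b then opp_pt a else x.
Proof.
move=> /refl_ends[ab nab anb nanb]; rewrite /refl permM !permE /=.
case: (x =P a) => [_|xa].
  by rewrite ![b == _]eq_sym (negPf nab) (negPf (opp_pt_neq b)).
case: (x =P b) => [_|xb].
  by rewrite ![a == _]eq_sym (negPf (opp_pt_neq a)) eq_sym (negPf anb).
by [].
Qed.

Lemma reflC a b : a.1 != b.1 -> refl a b = refl (opp_pt a) (opp_pt b).
Proof.
move=> /refl_ends[ab nab anb nanb]; rewrite /refl !opp_ptK.
by apply/commgP/conjg_fixP; rewrite tpermJ !tpermD // ?opp_pt_neq // eq_sym.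
Qed.

Lemma refl_opp a b : a.1 != b.1 -> refl a b \in 'C[opp_perm].
Proof.
move=> ab; apply/cent1P/commgP/conjg_fixP.
by rewrite [in LHS]/refl conjMg !tpermJ !opp_permE [RHS](reflC ab).
Qed.

Lemma reflK a b : a.1 != b.1 -> refl a b * refl a b = 1.
Proof.
move=> ab; rewrite {2}(reflC ab) /refl !opp_ptK -mulgA (mulgA (tperm (opp_pt a) _)).
by rewrite tperm2 mul1g tperm2.
Qed.

Lemma odd_refl a b : a.1 != b.1 -> odd_perm (refl a b) = false.
Proof.
by move=> /refl_ends[ab _ _ _]; rewrite odd_permM !odd_tperm opp_pt_eq ab.
Qed.

Lemma refl_fixes f a b : a.1 != b.1 -> odd_fun f -> fixes f (refl a b) = (f a == f b).
Proof.
move=> ab fo; apply/fixesP/eqP => [/(_ b) | fab x].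
  by rewrite reflE // eqxx; case: eqP => // <-.
rewrite reflE //.
case: eqP => [-> //|_]; case: eqP => [-> //|_].
by do 2?[case: eqP => [->|_]]; rewrite ?fo ?fab.
Qed.

End SignedPoints.

(** * Dominant vectors, their stabilizers, and the parity criterion for W *)

Section Dominance.

Variable n : nat.
Local Notation pt := (signed_pt n).
Local Notation sperm := (signed_perm n).
Local Notation opp_perm := (opp_perm n).
Implicit Types (a b x y : pt) (f v : pt -> int) (g h w s t : sperm).

(** The usual formula for the reflection in the root e_b - e_a; the factor 2 appears because a sum
    over signed points counts each coordinate twice. *)
Lemma pairing_refl (f g : pt -> int) a b : a.1 != b.1 -> odd_fun f -> odd_fun g ->
  (\sum_x g x * f (refl a b x) =
   \sum_x g x * f x - 2%:R * (g b - g a) * (f b - f a))%R.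
Proof.
move=> ab fo go; have [nab nnab nanb nanb'] := refl_ends ab.
have split4 (F : pt -> int) : (\sum_x F x = F a + (F b + (F (opp_pt a) +
    (F (opp_pt b) + \sum_(x | [&& x != a, x != b, x != opp_pt a & x != opp_pt b]) F x))))%R.
  rewrite (bigD1 a) // (bigD1 b) 1?eq_sym //= (bigD1 (opp_pt a)) /=; last first.
    by rewrite opp_pt_neq nnab.
  rewrite (bigD1 (opp_pt b)) /=; last by rewrite eq_sym nanb opp_pt_neq eq_sym nanb'.
  by do 4!congr (_ + _)%R; apply: eq_bigl => x; rewrite -!andbA.
rewrite !split4 (eq_bigr (fun x => g x * f x)%R); last first.
  by move=> x /and4P[xa xb xna xnb]; rewrite reflE // !ifN.
rewrite !reflE // !eqxx (negPf (opp_pt_neq a)) (negPf (opp_pt_neq b)) (negPf nnab).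
rewrite eq_sym (negPf nab) eq_sym (negPf nanb) [opp_pt b == opp_pt a]eq_sym (negPf nanb').
by rewrite !fo !go; ring.
Qed.

Definition vec (h : 'I_n -> int) : pt -> int :=
  fun x => if x.2 then (- h x.1)%R else h x.1.

Lemma odd_vec (h : 'I_n -> int) : odd_fun (vec h).
Proof. by case=> i []; rewrite /vec /= ?opprK. Qed.

(** The fundamental weight dual to the simple root e_b - e_a. The two half-spin weights, those of
    [u] and [s_1], are doubled to be integral. *)
Definition weight a b := vec (fun i =>
  if a.2 then 1 else if b.1 == 1%N :> nat then if i == 0%N :> nat then -1 else 1
  else (b.1 <= i)%:R)%R.

Lemma weightP a b a' b' : simple a b -> simple a' b' ->
  if (a', b') == (a, b) then (weight a b a' < weight a b b')%R
  else weight a b a' == weight a b b'.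
Proof.
case: a b a' b' => [i c] [j d] [i' c'] [j' d']; rewrite /simple /= => sab sab'.
have -> : (((i', c'), (j', d')) == ((i, c), (j, d))) =
   [&& (i' == i :> nat), c' == c, (j' == j :> nat) & d' == d].
  by rewrite !xpair_eqE -!andbA.
move: sab sab'; rewrite /weight /vec /=.
case: i j i' j' => [i ?] [j ?] [i' ?] [j' ?] /=.
case: c; case: c'; case: d; case: d' => //= sab sab'; rewrite ?andbT ?andbF;
  by repeat case: ifP; lia.
Qed.

Definition dominant f := forall a b, simple a b -> (f a <= f b)%R.

Definition rho := vec (fun i => i.+1%:R%R).

Lemma rho_lt a b : simple a b -> (rho a < rho b)%R.
Proof.
case: a b => [i c] [j d]; rewrite /simple /rho /vec /=.
by case: d => //; case: c => /= [/andP[/eqP-> /eqP->]|/eqP->] //; lia.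
Qed.

Lemma rho_bound x : (- n%:R <= rho x <= n%:R)%R.
Proof. by case: x => [[i lt_i]] []; rewrite /rho /vec /=; lia. Qed.

(* Reflecting in a wall of [A] with [f] on its wrong side increases the pairing
   with [rho]. *)
Lemma exists_dominant_gen (A : {set sperm}) f : A \subset gensD n -> odd_fun f ->
  exists2 m, m \in <<A>> &
    forall a b, simple a b -> refl a b \in A -> (f (m a) <= f (m b))%R.
Proof.
move=> sA fo.
pose F (m : sperm) : int := (\sum_x rho x * f (m x))%R.
case: (@arg_maxP _ _ _ 1 (mem <<A>>) F (group1 _)) => m mA mmax.
exists m => // a b sab rA; have ab := simple_neq sab.
have mo : odd_fun (f \o m).
  apply: odd_fun_comp => //.
  have /subsetP : <<A>> \subset 'C[opp_perm]; last exact.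
  rewrite gen_subG; apply/subsetP => s /(subsetP sA)/gensDP[c [d [scd ->]]].
  by rewrite refl_opp ?simple_neq.
have : (F (refl a b * m)%g <= F m)%R by apply: mmax; exact: groupM (mem_gen rA) mA.
have -> : F (refl a b * m) = (\sum_x rho x * (f \o m) (refl a b x))%R.
  by apply: eq_bigr => x _; rewrite permM.
rewrite (pairing_refl ab mo (odd_vec _)) /F /=.
by rewrite gerBl pmulr_rge0 ?subr_ge0 // mulr_gt0 // subr_gt0 rho_lt.
Qed.

Definition strictly_dominant f := forall a b, simple a b -> (f a < f b)%R.

Lemma pt_pos_gt0 (i : 'I_n) : (0 < i)%N -> exists j : 'I_n, i = j.+1 :> nat.
Proof.
case: i => [[|i] lt_i] //= _; have lt_i' : (i < n)%N by apply: leq_trans lt_i.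
by exists (Ordinal lt_i').
Qed.

Lemma simple_pred (j i : 'I_n) : i = j.+1 :> nat -> simple (j, false) (i, false).
Proof. by move=> e; rewrite /simple /= e. Qed.

Lemma simple_u (j i : 'I_n) : j = 0%N :> nat -> i = 1%N :> nat ->
  simple (j, true) (i, false).
Proof. by move=> e0 e1; rewrite /simple /= e0 e1. Qed.

(** The roots e_i - e_j and e_i + e_j with j < i are sums of simple roots. *)
Lemma dominant_le f (i j : 'I_n) c : odd_fun f -> dominant f ->
  (j < i)%N -> (f (j, c) <= f (i, false))%R.
Proof.
move=> fo fd; have [k] := ubnP (i : nat).
elim: k i j c => // k IHk i j c lt_ik lt_ji.
have [i' ei] := pt_pos_gt0 (leq_ltn_trans (leq0n j) lt_ji).
have le1 := fd _ _ (simple_pred ei).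
have fneg (l : 'I_n) : f (l, true) = (- f (l, false))%R by rewrite -fo.
have [lt_ji'|] := ltnP j i'.
  by apply: le_trans le1; apply: IHk => //; lia.
move=> le_i'j; have ej : j = i' by apply: val_inj => /=; lia.
rewrite {j}ej in lt_ji le_i'j *.
case: c; last exact: le1.
have [i'0|] := posnP i'.
  by apply: fd; apply: simple_u; lia.
case/pt_pos_gt0 => i'' ei'.
have lt_i'' : (i'' < i')%N by rewrite ei'.
have lt_i'k : (i' < k)%N by lia.
(* What remains is that f is nonnegative at [i']: adding the induction hypotheses for both signs of
   [i''] cancels the value there. *)
apply: le_trans le1; rewrite fneg -subr_ge0 opprK.
have := lerD (IHk i' i'' false lt_i'k lt_i'') (IHk i' i'' true lt_i'k lt_i'').
by rewrite fneg subrr.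
Qed.

Lemma strictly_dominant_lt f (i j : 'I_n) c : odd_fun f -> strictly_dominant f ->
  (j < i)%N -> (f (j, c) < f (i, false))%R.
Proof.
(* [r] is the half-sum of the positive roots, which pairs to 1 with each simple root; subtracting it
   turns strict dominance of an integral vector into dominance. *)
move=> fo fd lt_ji; pose r := vec (fun i => i%:R%R).
have ro : odd_fun r by apply: odd_vec.
have fro : odd_fun (fun x => f x - r x)%R by move=> x; rewrite fo ro; lia.
have frd : dominant (fun x => f x - r x)%R.
  move=> a b sab; have := fd _ _ sab; suff : (r b - r a <= 1)%R by lia.
  case: a b sab => [k d] [l e]; rewrite /r /vec /simple /=.
  by case: e => //; case: d => /= [/andP[/eqP-> /eqP->]|/eqP->]; lia.
have := dominant_le c fro frd lt_ji; rewrite /r /vec /=.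
by case: c; lia.
Qed.

(** W acts freely on chambers. From the last coordinate downwards, the value of f at i is the strict
    maximum over the signed coordinates not yet known to be fixed, so w must fix i. Dominance leaves
    the sign at coordinate 0 open; parity decides it. *)
Lemma strictly_dominant_eq1 f w : odd_fun f -> strictly_dominant f ->
  dominant (f \o w) -> w \in 'C[opp_perm] -> ~~ odd_perm w -> w = 1.
Proof.
move=> fo fd fwd cw ew; have /cent_oppP wopp := cw.
have fwo : odd_fun (f \o w) by apply: odd_fun_comp.
have fneg (g : pt -> int) (l : 'I_n) : odd_fun g -> g (l, true) = (- g (l, false))%R.
  by move=> go; rewrite -go.
have fix_pos k (i : 'I_n) : (n - k <= i)%N -> (0 < i)%N ->
    forall c, w (i, c) = (i, c).
  elim: k i => [|k IHk] i le_i i_gt0; first by case: i le_i {i_gt0} => i lt_i /=; lia.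
  suff wi : w (i, false) = (i, false).
    by case=> //; rewrite -[(i, true)]/(opp_pt (i, false)) wopp wi.
  have [|lt_i] := leqP (n - k) i; first by move/IHk->.
  have IHx x : (i < x.1)%N -> w x = x.
    by case: x => l c /= lt_il; apply: IHk; lia.
  have above x : (x.1 <= i)%N -> ((w x).1 <= i)%N.
    move=> xi; rewrite leqNgt; apply/negP => wxi.
    by move: xi; rewrite leqNgt -(perm_inj (IHx _ wxi)) wxi.
  have below x : ((w x).1 <= i)%N -> (x.1 <= i)%N.
    by move=> wxi; rewrite leqNgt; apply/negP => xi; rewrite IHx // leqNgt xi in wxi.
  have [j ej] := pt_pos_gt0 i_gt0; have lt_ji : (j < i)%N by rewrite ej.
  have fi_gt0 : (0 < f (i, false))%R.
    have := ltrD (strictly_dominant_lt false fo fd lt_ji)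
      (strictly_dominant_lt true fo fd lt_ji).
    by rewrite fneg // subrr; lia.
  have fwi_ge0 : (0 <= f (w (i, false)))%R.
    have := lerD (dominant_le false fwo fwd lt_ji) (dominant_le true fwo fwd lt_ji).
    by rewrite fneg // subrr /=; lia.
  (* The preimage of i under w is some signed l with l <= i. If l < i, dominance of [f \o w]
     applies; if it is -i, the value of f at i would be at most 0. *)
  have fwi : (f (i, false) <= f (w (i, false)))%R.
    case: (w^-1 (i, false)) (permKV w (i, false)) => l c wV.
    have : (l <= i)%N by apply: (below (l, c)); rewrite wV.
    rewrite leq_eqVlt => /predU1P[/val_inj el | lt_li]; last first.
      by rewrite -[X in (f X <= _)%R]wV; exact: (dominant_le c fwo fwd lt_li).
    rewrite el in wV; case: c wV => wV; last by rewrite wV.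
    have := fneg (f \o w) i fwo; rewrite /= wV => fwi.
    by move: fi_gt0; rewrite fwi oppr_gt0 ltNge fwi_ge0.
  have : ((w (i, false)).1 <= i)%N by apply: above.
  case: (w (i, false)) fwi_ge0 fwi => l c /= fwi_ge0 fwi; rewrite leq_eqVlt.
  case/predU1P => [/val_inj el|/(strictly_dominant_lt c fo fd)]; last first.
    by rewrite ltNge fwi.
  rewrite el in fwi_ge0 *; case: c fwi_ge0 {fwi} => //.
  by rewrite fneg // oppr_ge0 leNgt fi_gt0.
have [n0|n_gt0] := posnP n; first by apply/permP => -[[i lt_i] c]; exfalso; lia.
pose i0 : 'I_n := Ordinal n_gt0.
have fixw x : x.1 != i0 -> w x = x.
  case: x => i c /= neq; apply: (fix_pos n); rewrite ?subnn // lt0n.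
  by apply: contra neq => /eqP i_0; apply/eqP/val_inj.
have w0 : (w (i0, false)).1 = i0.
  apply/eqP/negPn/negP => neq; have := fixw _ neq => /perm_inj e.
  by rewrite e eqxx in neq.
case e : (w (i0, false)).2.
  suff ew' : w = tperm (i0, false) (i0, true) by rewrite ew' odd_tperm in ew.
  have w00 : w (i0, false) = (i0, true) by rewrite [LHS]surjective_pairing w0 e.
  apply/permP => x; case: tpermP => [->|->|] //.
    by rewrite -[(i0, true)]/(opp_pt (i0, false)) wopp w00.
  case: x => i c; case: (eqVneq i i0) => [->|neq _ _]; last exact: fixw.
  by case: c => [_ []|[]].
apply/permP => x; rewrite perm1; case: (eqVneq x.1 i0) => [x0|]; last exact: fixw.
have w00 : w (i0, false) = (i0, false) by rewrite [LHS]surjective_pairing w0 e.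
case: x x0 => i [] /= ->; last exact: w00.
by rewrite -[(i0, true)]/(opp_pt (i0, false)) wopp w00.
Qed.

Lemma weylD_even w : w \in weylD n -> (w \in 'C[opp_perm]) /\ ~~ odd_perm w.
Proof.
have /subsetP sub : weylD n \subset 'C[opp_perm] :&: 'Alt_pt.
  rewrite gen_subG; apply/subsetP => s /gensDP[a [b [sab ->]]].
  by rewrite inE refl_opp ?Alt_even ?inE ?odd_refl ?simple_neq.
by move=> /sub /setIP[-> ]; rewrite Alt_even.
Qed.

Definition simple_fixer f : {set sperm} := [set s in gensD n | fixes f s].

(* For large [N] the vector [N f + rho] is strictly dominant, and its composition with
   [m * w] is dominant for a suitable [m] in the generated group, so that [m * w = 1]. *)
Lemma dominant_stabilizer f w : odd_fun f -> dominant f -> w \in 'C[opp_perm] ->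
  ~~ odd_perm w -> fixes f w -> w \in <<simple_fixer f>>.
Proof.
move=> fo fd cw ew fw; set A := simple_fixer f.
have sAS : A \subset gensD n by apply/subsetP => s; rewrite inE => /andP[].
have roo : odd_fun rho by apply: odd_vec.
have [m mA mdom] := exists_dominant_gen sAS (odd_fun_comp roo cw).
have mW : m \in weylD n by apply: subsetP mA; rewrite genS.
have [cm em] := weylD_even mW.
have fm : fixes f m by move: mA; apply: fixes_gen => s; rewrite inE => /andP[].
(* Two values of [rho] differ by at most 2n, while f, being integral, jumps by at least 1 across a
   wall that does not contain it. *)
pose N : int := (n.*2)%:R%R.
suff mw1 : m * w = 1 by rewrite -(groupMl _ mA) mw1 group1.
pose y x := (N * f x + rho x)%R.
apply: (@strictly_dominant_eq1 y).
- by move=> x; rewrite /y fo roo; ring.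
- by move=> a b sab; rewrite /y ler_ltD ?rho_lt // ler_wpM2l // fd.
- move=> a b sab; rewrite /y /= !permM.
  rewrite !(fixesP _ _ fw) !(fixesP _ _ fm).
  have [rA|rnA] := boolP (refl a b \in A).
    by rewrite lerD // ?ler_wpM2l // ?fd //; exact: mdom.
  have : (f a < f b)%R.
    rewrite lt_neqAle fd // andbT; apply: contra rnA => fab.
    by rewrite inE refl_fixes ?simple_neq // fab andbT; apply/gensDP; exists a, b.
  move=> fab; rewrite -subr_ge0.
  have /andP[_ ra] := rho_bound (w (m a)); have /andP[rb _] := rho_bound (w (m b)).
  have Nfab : (N <= N * (f b - f a))%R by rewrite ler_peMr // -gtz0_ge1 subr_gt0.
  have := lerD Nfab (lerB rb ra); rewrite mulrBr /N -opprD -natrD addnn subrr.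
  by rewrite opprD addrACA.
- by rewrite groupM.
- by rewrite odd_permM negb_add (negPf em) (negPf ew).
Qed.

(** On the 2n points, evenness means an even number of sign changes. That such elements are
    generated by S is the stabilizer statement for the zero vector, which everything fixes. *)
Lemma weylDP w : reflect (w \in 'C[opp_perm] /\ ~~ odd_perm w) (w \in weylD n).
Proof.
apply: (iffP idP) => [|[cw ew]]; first exact: weylD_even.
have zo : odd_fun (fun=> 0%R) by [].
have : w \in <<simple_fixer (fun=> 0%R)>>.
  by apply: dominant_stabilizer => //; apply/fixesP.
by apply: subsetP; apply: genS; apply/subsetP => s; rewrite inE => /andP[].
Qed.

End Dominance.

(** * Parabolic subgroups and Coxeter elements *)

Section Parabolics.

Variable n : nat.
Local Notation pt := (signed_pt n).
Local Notation sperm := (signed_perm n).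
Local Notation opp_perm := (opp_perm n).
Implicit Types (a b x y : pt) (f v : pt -> int) (g h w s t : sperm).

(** A point in the open face of the dominant chamber cut out by the walls of J. *)
Definition par_vec (J : {set sperm}) : pt -> int := fun x =>
  (\sum_(ab : pt * pt | simple ab.1 ab.2 && (refl ab.1 ab.2 \notin J))
     weight ab.1 ab.2 x)%R.

Lemma odd_par_vec J : odd_fun (par_vec J).
Proof.
by move=> x; rewrite /par_vec -sumrN; apply: eq_bigr => ab _; rewrite /weight odd_vec.
Qed.

Lemma weight_le a b a' b' : simple a b -> simple a' b' ->
  (weight a b a' <= weight a b b')%R.
Proof.
by move=> sab sab'; have := weightP sab sab'; case: ifP => _ => [/ltW|/eqP->].
Qed.

Lemma par_vec_dominant J : dominant (par_vec J).
Proof.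
by move=> a b sab; apply: ler_sum => -[c d] /= /andP[scd _]; apply: weight_le.
Qed.

Lemma par_vec_eq (J : {set sperm}) a b : simple a b ->
  (par_vec J a == par_vec J b) = (refl a b \in J).
Proof.
move=> sab; case: (boolP (refl a b \in J)) => abJ.
  apply/eqP/eq_bigr => -[c d] /= /andP[scd cdJ]; have := weightP scd sab.
  by case: eqP => [[ec ed] | _ /eqP//]; rewrite -ec -ed abJ in cdJ.
rewrite lt_eqF // /par_vec (bigD1 (a, b)) /= ?sab // [X in (_ < X)%R](bigD1 (a, b)) /= ?sab //.
rewrite ltr_leD //; first by have := weightP sab sab; rewrite eqxx.
by apply: ler_sum => -[c d] /= /andP[/andP[scd _] _]; apply: weight_le.
Qed.

Lemma simple_fixer_par_vec (J : {set sperm}) : J \subset gensD n ->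
  simple_fixer (par_vec J) = J.
Proof.
move=> sJ; apply/setP => s; rewrite inE; apply/andP/idP => [[]|sJs].
  move=> /gensDP[a [b [sab ->]]].
  by rewrite refl_fixes ?simple_neq ?par_vec_eq //; apply: odd_par_vec.
split; first exact: subsetP sJs.
have /gensDP[a [b [sab es]]] := subsetP sJ _ sJs.
by rewrite es refl_fixes ?simple_neq ?par_vec_eq -?es //; apply: odd_par_vec.
Qed.

Lemma dominant_fixerE f w : odd_fun f -> dominant f -> w \in weylD n ->
  (w \in <<simple_fixer f>>) = fixes f w.
Proof.
move=> fo fd /weylD_even[cw ew]; apply/idP/idP; last exact: dominant_stabilizer.
by apply: fixes_gen => s; rewrite inE => /andP[].
Qed.

Lemma parabolicE (J : {set sperm}) w : J \subset gensD n -> w \in weylD n ->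
  (w \in <<J>>) = fixes (par_vec J) w.
Proof.
move=> sJ wW; rewrite -{1}(simple_fixer_par_vec sJ) dominant_fixerE //.
  exact: odd_par_vec.
exact: par_vec_dominant.
Qed.

(* Pairing the equation [f \o c = f] with the fundamental weight of the first
   letter isolates that letter. *)
Lemma prod_fixes (s : seq sperm) f : uniq s -> {subset s <= gensD n} ->
  odd_fun f -> fixes f (\prod_(t <- s) t) -> {in s, forall t, fixes f t}.
Proof.
elim: s => [|t s IHs] //= /andP[tns us] sS fo; rewrite big_cons.
set c := (\prod_(t <- s) t) => ftc.
have sS' : {subset s <= gensD n} by move=> r rs; rewrite sS // inE rs orbT.
suff ft : fixes f t.
  have fc : fixes f c by rewrite -(mulKg t c) fixesM ?fixesV.
  by move=> r; rewrite inE => /predU1P[-> //|]; apply: IHs.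
have /gensDP[a [b [sab et]]] : t \in gensD n by rewrite sS ?mem_head.
have ab := simple_neq sab; have wo : odd_fun (weight a b) by apply: odd_vec.
have wc : fixes (weight a b) c.
  rewrite /c; elim: (s) tns sS' => [|r s' IHs'].
    by rewrite big_nil => *; apply: fixes1.
  rewrite inE negb_or big_cons => /andP[tr ts'] sS'; rewrite fixesM ?IHs' //; last first.
    by move=> q qs; rewrite sS' // inE qs orbT.
  have /gensDP[a' [b' [sab' er]]] := sS' r (mem_head _ _).
  rewrite er refl_fixes ?simple_neq //; have := weightP sab sab'.
  by case: eqP => // -[ea eb]; rewrite et er ea eb eqxx in tr.
have fct x : f (c x) = f (t x).
  by have := fixesP _ _ ftc (t x); rewrite permM -[t (t x)]permM {1 2}et reflK // perm1.
have := pairing_refl ab fo wo.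
rewrite [LHS](_ : _ = \sum_x weight a b x * f x)%R; last first.
  rewrite [RHS](reindex_inj (@perm_inj _ c)) /=; apply: eq_bigr => x _.
  by rewrite (fixesP _ _ wc) fct et.
move/esym/eqP; rewrite -subr_eq0 addrAC subrr sub0r oppr_eq0 !mulf_eq0 /=.
rewrite subr_eq0 [_ == weight a b a]gt_eqF /=; last first.
  by have := weightP sab sab; rewrite eqxx.
by rewrite et refl_fixes // subr_eq0 eq_sym.
Qed.

Lemma coxeter_fixes (J : {set sperm}) c f : J \subset gensD n -> is_coxeter_elt J c ->
  odd_fun f -> fixes f c -> {in <<J>>, forall w, fixes f w}.
Proof.
move=> sJ [s ps ->] fo fc; apply: fixes_gen => t tJ.
have us : uniq s by rewrite (perm_uniq ps) enum_uniq.
have ms : s =i J by move=> r; rewrite (perm_mem ps) mem_enum.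
apply: (prod_fixes us _ fo fc); last by rewrite ms.
by move=> r; rewrite ms; apply: subsetP.
Qed.

Lemma coxeter_gen (J : {set sperm}) c : is_coxeter_elt J c -> c \in <<J>>.
Proof.
move=> [s ps ->]; rewrite big_seq; apply: group_prod => t ts.
by rewrite mem_gen // -mem_enum -(perm_mem ps).
Qed.

Lemma gen_sub_weylD (J : {set sperm}) : J \subset gensD n -> <<J>> \subset weylD n.
Proof. exact: genS. Qed.

Lemma coxeter_conj_sub (J K : {set sperm}) c (x : sperm) :
  J \subset gensD n -> K \subset gensD n -> is_coxeter_elt K c -> x \in weylD n ->
  (<<K>> \subset <<J>> :^ x) = (c \in <<J>> :^ x).
Proof.
move=> sJ sK cK xW; apply/idP/idP => [/subsetP|]; first by apply; apply: coxeter_gen.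
have sKW := subsetP (gen_sub_weylD sK); have cx := (weylD_even (groupVr xW)).1.
rewrite mem_conjg parabolicE // ?groupJ ?groupV //; last by rewrite sKW ?coxeter_gen.
rewrite fixes_conj => fc; apply/subsetP => w wK.
rewrite mem_conjg parabolicE // ?groupJ ?groupV //; last exact: sKW.
rewrite fixes_conj; apply: coxeter_fixes sK cK _ fc w wK.
by apply: odd_fun_comp cx; apply: odd_par_vec.
Qed.

End Parabolics.

(** * Cycles of signed permutations *)

Lemma porbit_mod (T : finType) (g : {perm T}) k x :
  (g ^+ (k %% #|porbit g x|)) x = (g ^+ k) x.
Proof.
set m := #|_|; have gm : (g ^+ m) x = x by rewrite permX iter_porbit.
rewrite [in RHS](divn_eq k m) expgD permM mulnC expgM; congr (_ _).
by rewrite permX_fix.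
Qed.

Lemma eq_porbit_mod (T : finType) (g : {perm T}) k l x :
  ((g ^+ k) x == (g ^+ l) x) = (k == l %[mod #|porbit g x|]).
Proof.
rewrite -(porbit_mod g k) -(porbit_mod g l); set m := #|porbit g x|.
have m_gt0 : (0 < m)%N by rewrite lt0n card_porbit_neq0.
rewrite -(nth_uniq x _ _ (uniq_traject_porbit g x)) ?size_traject ?ltn_pmod //.
by rewrite !nth_traject ?ltn_pmod // -!permX.
Qed.

Section Cycles.

Variable n : nat.
Local Notation pt := (signed_pt n).
Local Notation sperm := (signed_perm n).
Local Notation opp_perm := (opp_perm n).
Local Notation opp_ptK := (@opp_ptK n).
Implicit Types (a b x y : pt) (f v : pt -> int) (g h w s t : sperm).

Lemma perm_opp w x : w \in 'C[opp_perm] -> w (opp_pt x) = opp_pt (w x).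
Proof. by move/cent_oppP. Qed.

Lemma permX_opp w k x : w \in 'C[opp_perm] -> (w ^+ k) (opp_pt x) = opp_pt ((w ^+ k) x).
Proof. by move=> cw; rewrite perm_opp ?groupX. Qed.

Lemma porbit_opp w x y : w \in 'C[opp_perm] ->
  (opp_pt y \in porbit w (opp_pt x)) = (y \in porbit w x).
Proof.
move=> cw; apply/porbitP/porbitP => -[k e]; exists k; last by rewrite permX_opp // -e.
by apply: (inv_inj opp_ptK); rewrite e permX_opp.
Qed.

Lemma fixes_porbit f w x y : fixes f w -> y \in porbit w x -> f y = f x.
Proof. by move=> fw /porbitP[k ->]; apply: fixesP; apply: fixesX. Qed.

(** These are the points on the negative cycles of w. *)
Definition selfneg w x := opp_pt x \in porbit w x.

Lemma selfneg_opp w x : w \in 'C[opp_perm] -> selfneg w (opp_pt x) = selfneg w x.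
Proof. by move=> cw; rewrite /selfneg porbit_opp. Qed.

Lemma selfneg_porbit w x y : w \in 'C[opp_perm] -> y \in porbit w x ->
  selfneg w y = selfneg w x.
Proof.
move=> cw; rewrite /selfneg => yx; have /eqP yxE : porbit w y == porbit w x by rewrite eq_porbit_mem.
by rewrite yxE -!eq_porbit_mem; congr (_ == _); apply/eqP; rewrite eq_porbit_mem porbit_opp.
Qed.

Lemma fixes_selfneg f w x : odd_fun f -> fixes f w -> selfneg w x -> f x = 0%R.
Proof. by move=> fo fw /(fixes_porbit fw); rewrite fo; lia. Qed.

(* Only three properties matter: this function is odd, vanishes exactly on the
   negative cycles of w, and takes distinct values on its other cycles. *)
Definition cycle_vec w x : int :=
  let r := enum_rank (porbit w x) in let r' := enum_rank (porbit w (opp_pt x)) in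
  if (r' < r)%N then r.+1%:R%R else if (r < r')%N then (- r'.+1%:R)%R else 0%R.

Lemma odd_cycle_vec w : odd_fun (cycle_vec w).
Proof.
move=> x; rewrite /cycle_vec opp_ptK.
by case: (ltngtP (enum_rank (porbit w x)) (enum_rank (porbit w (opp_pt x)))) => _; rewrite ?opprK ?oppr0.
Qed.

Lemma fixes_cycle_vec w : w \in 'C[opp_perm] -> fixes (cycle_vec w) w.
Proof.
move=> cw; apply/fixesP => x; have porb y : porbit w (w y) = porbit w y.
  by rewrite -{2}(expg1 w) porbit_perm.
by rewrite /cycle_vec -perm_opp // !porb.
Qed.

Lemma cycle_vec_eq0 w x : (cycle_vec w x == 0%R) = selfneg w x.
Proof.
rewrite /selfneg -eq_porbit_mem /cycle_vec.
rewrite -(inj_eq (@enum_rank_inj _)) -(inj_eq val_inj) /=.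
by case: ltngtP; rewrite ?oppr_eq0 ?pnatr_eq0 ?eqxx.
Qed.

Lemma cycle_vec_inj w x y : w \in 'C[opp_perm] -> ~~ selfneg w x ->
  (cycle_vec w y == cycle_vec w x) = (y \in porbit w x).
Proof.
move=> cw; rewrite -cycle_vec_eq0 => nx; apply/eqP/idP => [|/(fixes_porbit (fixes_cycle_vec cw))//].
have rank_inj (A B : {set pt}) : enum_rank A = enum_rank B :> nat -> A = B.
  by move/val_inj/enum_rank_inj.
move: nx; rewrite /cycle_vec.
case: (ltngtP (enum_rank (porbit w x))) => // _ _; case: ltngtP => _ e;
  try by exfalso; move: e; lia.
- have /rank_inj/eqP : enum_rank (porbit w (opp_pt y)) = enum_rank (porbit w (opp_pt x)) :> nat.
    by move: e; lia.
  by rewrite eq_porbit_mem porbit_opp.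
- have /rank_inj/eqP : enum_rank (porbit w y) = enum_rank (porbit w x) :> nat.
    by move: e; lia.
  by rewrite eq_porbit_mem.
Qed.

(** A vector fixed by g vanishes on negative cycles and is constant on the others, hence is a
    function of [cycle_vec g]. The stabilizer of [cycle_vec g] in W is thus the parabolic closure of
    g. *)
Lemma fixes_of_cycle_vec f g w : g \in 'C[opp_perm] -> odd_fun f -> fixes f g ->
  fixes (cycle_vec g) w -> fixes f w.
Proof.
move=> cg fo fg cvw; apply/fixesP => x; have cvx := fixesP _ _ cvw x.
have [sx|nx] := boolP (selfneg g x).
  rewrite (fixes_selfneg fo fg sx) (fixes_selfneg fo fg) //.
  by rewrite -cycle_vec_eq0 cvx cycle_vec_eq0.
by apply: (fixes_porbit fg); rewrite -cycle_vec_inj // cvx.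
Qed.

(** By genericity of [cycle_vec], this says that g and h fix the same odd functions. *)
Definition same_fixed g h := fixes (cycle_vec g) h && fixes (cycle_vec h) g.

Section SameFixed.

Variables g h : sperm.
Hypotheses (cg : g \in 'C[opp_perm]) (ch : h \in 'C[opp_perm]) (gh : same_fixed g h).

Lemma same_fixed_selfneg x : selfneg g x = selfneg h x.
Proof.
have [fh fg] := andP gh; apply/idP/idP => s; rewrite -cycle_vec_eq0.
  by rewrite (fixes_selfneg (odd_cycle_vec _) fg s).
by rewrite (fixes_selfneg (odd_cycle_vec _) fh s).
Qed.

Lemma same_fixed_porbit x : ~~ selfneg g x -> porbit g x = porbit h x.
Proof.
have [fh fg] := andP gh => nx; apply/setP => y.
apply/idP/idP => yx; last by rewrite -cycle_vec_inj // (fixes_porbit fh yx).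
by rewrite -cycle_vec_inj -?same_fixed_selfneg // (fixes_porbit fg yx).
Qed.

End SameFixed.

(** In the second case the negative cycles are those of a Coxeter element of type D_k: one of length
    1, through z, and one of length k - 1, through y. *)
Definition cox_type g :=
  (forall x, ~~ selfneg g x) \/
  exists z y, [/\ g z = opp_pt z, y != z, y != opp_pt z, selfneg g y &
    forall x, selfneg g x -> (x == z) || (x == opp_pt z) || (x \in porbit g y)].

Definition flip (e : bool) x := if e then opp_pt x else x.

Lemma flip_perm w e x : w \in 'C[opp_perm] -> w (flip e x) = flip e (w x).
Proof. by move=> cw; case: e; rewrite /= ?perm_opp. Qed.

Lemma flipK e : involutive (flip e).
Proof. by case: e => x //=; rewrite opp_ptK. Qed.

Lemma flip_flip e e' x : flip e (flip e' x) = flip (e (+) e') x.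
Proof. by case: e; case: e'; rewrite /= ?opp_ptK. Qed.

Definition signed_orbit w x := porbit w x :|: porbit w (opp_pt x).

Lemma signed_orbitP w x y : w \in 'C[opp_perm] ->
  reflect (exists e k, y = flip e ((w ^+ k) x)) (y \in signed_orbit w x).
Proof.
move=> cw; apply: (iffP setUP) => [[]/porbitP[k ->] | [[] [k ->]]] /=.
- by exists false, k.
- by exists true, k; rewrite /= permX_opp.
- by right; rewrite -permX_opp // mem_porbit.
- by left; rewrite mem_porbit.
Qed.

Lemma signed_orbit_id w x : x \in signed_orbit w x.
Proof. by rewrite inE porbit_id. Qed.

Lemma signed_orbit_eq w x y : w \in 'C[opp_perm] -> y \in signed_orbit w x ->
  signed_orbit w y = signed_orbit w x.
Proof.
move=> cw /setUP[]; rewrite -eq_porbit_mem => /eqP yx; rewrite /signed_orbit yx.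
  congr (_ :|: _); apply/eqP; rewrite eq_porbit_mem porbit_opp //.
  by rewrite -eq_porbit_mem yx.
rewrite setUC; congr (_ :|: _); apply/eqP; rewrite eq_porbit_mem -porbit_opp // opp_ptK.
by rewrite -eq_porbit_mem yx.
Qed.

(** If [w ^+ j] negates x with j less than the cycle length m, then m divides 2j, and 0 < 2j < 2m
    leaves only 2j = m. *)
Lemma selfneg_half w x : w \in 'C[opp_perm] -> selfneg w x ->
  (w ^+ #|porbit w x|./2) x = opp_pt x.
Proof.
move=> cw; rewrite /selfneg porbit_traject => /trajectP[j lt_j]; rewrite -permX => ej.
have : (w ^+ (j + j)) x == (w ^+ 0) x.
  by rewrite expgD permM -ej permX_opp // -ej opp_ptK perm1.
rewrite eq_porbit_mod mod0n => /dvdnP[q eq_j].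
have j_gt0 : (0 < j)%N.
  by rewrite lt0n; apply: contra_eq_neq ej => ->; rewrite perm1 opp_pt_neq.
have q1 : q = 1%N by move: eq_j j_gt0 lt_j; case: q => [|[|q]]; nia.
by rewrite ej; congr ((w ^+ _) x); move: eq_j; rewrite q1; lia.
Qed.

(** Coincidences among the signed iterates of x depend only on the length and the sign of its cycle;
    this makes a conjugator defined through base points well defined and injective. *)
Lemma eq_flip_porbit w x e k l : w \in 'C[opp_perm] ->
  (flip e ((w ^+ k) x) == (w ^+ l) x) =
  if e then selfneg w x && (k + #|porbit w x|./2 == l %[mod #|porbit w x|])
  else k == l %[mod #|porbit w x|].
Proof.
move=> cw; case: e => /=; last exact: eq_porbit_mod.
have [sx|nx] /= := boolP (selfneg w x).
  by rewrite -eq_porbit_mod addnC expgD permM selfneg_half // permX_opp.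
apply: contraNF nx => /eqP e; rewrite -(selfneg_porbit cw (mem_porbit w k x)).
by rewrite /selfneg e -eq_porbit_mem !porbit_perm.
Qed.

(* The conjugator sends [flip e ((g ^+ k) b)] to [flip e ((h ^+ k) (beta b))], where b
   runs over base points of the signed orbits of g. *)
Lemma signed_conj (g h : sperm) (beta : pt -> pt) :
  g \in 'C[opp_perm] -> h \in 'C[opp_perm] ->
  (forall x, #|porbit h (beta x)| = #|porbit g x|) ->
  (forall x, selfneg h (beta x) = selfneg g x) ->
  (forall x y, beta y \in signed_orbit h (beta x) -> y \in signed_orbit g x) ->
  exists2 t, t \in 'C[opp_perm] & g ^ t = h /\
    forall x, exists b e k, x = flip e ((g ^+ k) b) /\ t x = flip e ((h ^+ k) (beta b)).
Proof.
move=> cg ch beta_card beta_selfneg beta_inj.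
(* The pick depends only on the orbit as a set, so [base] is constant on it; the default is never
   reached, since the orbit contains x. *)
pose base x := odflt x [pick y in signed_orbit g x].
have base_in x : base x \in signed_orbit g x.
  by rewrite /base; case: pickP => //= _; apply: signed_orbit_id.
have base_eq x y : y \in signed_orbit g x -> base y = base x.
  move=> yx; rewrite /base (signed_orbit_eq cg yx); case: pickP => //=.
  by move/(_ x); rewrite signed_orbit_id.
pose P x (ek : bool * nat) := x == flip ek.1 ((g ^+ ek.2) (base x)).
have exP x : exists ek, P x ek.
  have : x \in signed_orbit g (base x).
    by rewrite (signed_orbit_eq cg (base_in x)) signed_orbit_id.
  by case/(signed_orbitP _ _ cg) => e [k ek]; exists (e, k); apply/eqP.
pose phi x := let ek := xchoose (exP x) in flip ek.1 ((h ^+ ek.2) (beta (base x))).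
have beta_eq b e e' k l : (flip e ((g ^+ k) b) == flip e' ((g ^+ l) b)) =
    (flip e ((h ^+ k) (beta b)) == flip e' ((h ^+ l) (beta b))).
  rewrite -(inj_eq (inv_inj (flipK e'))) flipK flip_flip eq_flip_porbit //.
  rewrite -[in RHS](inj_eq (inv_inj (flipK e'))) flipK flip_flip eq_flip_porbit //.
  by rewrite beta_card beta_selfneg.
have phiE e k x : x = flip e ((g ^+ k) (base x)) -> phi x = flip e ((h ^+ k) (beta (base x))).
  move=> ex; apply/eqP; rewrite -beta_eq -ex eq_sym.
  exact: (xchooseP (exP x)).
have phi_inj : injective phi.
  move=> x y exy.
  have [ek /eqP ex] := exP x; have [fl /eqP ey] := exP y.
  have bxy : base x = base y.
    suff : base y \in signed_orbit g (base x).
      by rewrite (signed_orbit_eq cg (base_in x)) => /base_eq <-; apply: base_eq.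
    apply: beta_inj.
    have hx : phi x \in signed_orbit h (beta (base x)).
      by apply/signed_orbitP => //; exists ek.1, ek.2; apply: phiE.
    have hy : phi x \in signed_orbit h (beta (base y)).
      by rewrite exy; apply/signed_orbitP => //; exists fl.1, fl.2; apply: phiE.
    by rewrite -(signed_orbit_eq ch hx) (signed_orbit_eq ch hy) signed_orbit_id.
  apply/eqP; rewrite ex ey -bxy beta_eq {2}bxy.
  by rewrite -(phiE _ _ _ ex) -(phiE _ _ _ ey) exy.
pose t : sperm := perm phi_inj.
have base_g x : base (g x) = base x.
  by apply: base_eq; rewrite inE -{1}(expg1 g) mem_porbit.
have base_opp x : base (opp_pt x) = base x.
  by apply: base_eq; rewrite inE porbit_id orbT.
exists t.
  apply/cent_oppP => x; rewrite !permE; have [[e k] /eqP /= ex] := exP x.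
  rewrite (phiE _ _ _ ex) (phiE (true (+) e) k) ?base_opp -?flip_flip //.
  by rewrite {1}ex.
split=> [|x].
  apply/permP => y; rewrite -(permKV t y); set x := t^-1 y; rewrite permJ !permE.
  have [[e k] /eqP /= ex] := exP x.
  rewrite (phiE _ _ _ ex) (phiE e k.+1) ?base_g ?expgSr ?permM ?flip_perm //.
  by rewrite {1}ex flip_perm.
have [[e k] /eqP /= ex] := exP x; exists (base x), e, k; split=> //.
by rewrite permE; apply: phiE.
Qed.

End Cycles.

(** * Elements of Coxeter type with the same fixed vectors are conjugate in W *)

Section Conjugacy.

Variable n : nat.
Local Notation pt := (signed_pt n).
Local Notation sperm := (signed_perm n).
Local Notation opp_perm := (opp_perm n).
Local Notation opp_ptK := (@opp_ptK n).
Implicit Types (a b x y : pt) (f v : pt -> int) (g h w s t : sperm).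

Lemma conj_opp_permE w x : (w ^ opp_perm) x = opp_pt (w (opp_pt x)).
Proof. by rewrite -[in LHS](opp_ptK x) -[opp_pt (opp_pt x)]opp_permE permJ opp_permE. Qed.

(** The points with f > 0 form one half of the signed points, stable under w. Hence w is a
    permutation r of this half times its mirror image, and both have the same parity. *)
Lemma fixes_even f w : w \in 'C[opp_perm] -> odd_fun f -> fixes f w ->
  (forall x, f x != 0%R) -> ~~ odd_perm w.
Proof.
move=> cw fo fw fn0; pose X := [set x | (0 < f x)%R].
have XN x : (opp_pt x \in X) = (x \notin X).
  by rewrite !inE fo oppr_gt0 lt_neqAle fn0 leNgt.
have wX x : (w x \in X) = (x \in X) by rewrite !inE (fixesP _ _ fw).
have wN : w \in 'N(X | 'P) by apply/astabsP.
pose r := restr_perm X w.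
have rE x : r x = if x \in X then w x else x.
  case: ifPn => [xX|]; first by rewrite restr_permE.
  exact: out_perm (restr_perm_on _ _).
suff -> : w = r * r ^ opp_perm by rewrite odd_permM odd_permJ addbb.
apply/permP => x; rewrite permM conj_opp_permE !rE XN.
case: (boolP (x \in X)) => xX; first by rewrite wX xX opp_ptK.
by rewrite xX perm_opp // opp_ptK.
Qed.

Lemma signed_orbit_selfneg w x y : w \in 'C[opp_perm] -> y \in signed_orbit w x ->
  selfneg w y = selfneg w x.
Proof.
by move=> cw /setUP[] /(selfneg_porbit cw) -> //; rewrite selfneg_opp.
Qed.

Lemma cox_type_porbits g z y : g \in 'C[opp_perm] ->
  g z = opp_pt z -> y != z -> y != opp_pt z -> selfneg g y ->
  (forall x, selfneg g x -> (x == z) || (x == opp_pt z) || (x \in porbit g y)) ->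
  [/\ porbit g z = [set z; opp_pt z] /\ porbit g (opp_pt z) = [set z; opp_pt z],
      z \notin porbit g y, opp_pt z \notin porbit g y, selfneg g z &
      #|porbit g y| = (#|[set x | selfneg g x]| - 2)%N].
Proof.
move=> cg gz yz ynz sy sP.
have z_in k : (g ^+ k) z \in [set z; opp_pt z].
  elim: k => [|k]; first by rewrite perm1 set21.
  by rewrite expgSr permM => /set2P[->|->]; rewrite ?perm_opp // gz ?opp_ptK !inE eqxx ?orbT.
have pz : porbit g z = [set z; opp_pt z].
  apply/setP => x; apply/idP/set2P => [/porbitP[k ->]|[->|->]]; last 2 first.
  - exact: porbit_id.
  - by rewrite -gz -{1}(expg1 g) mem_porbit.
  exact/set2P.
have sz : selfneg g z by rewrite /selfneg pz set22.
have pnz : porbit g (opp_pt z) = [set z; opp_pt z].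
  by rewrite -pz; apply/eqP; rewrite eq_porbit_mem.
have zy : z \notin porbit g y.
  by rewrite porbit_sym pz; apply/set2P => -[] /eqP; apply/negP.
have nzy : opp_pt z \notin porbit g y.
  by rewrite porbit_sym pnz; apply/set2P => -[] /eqP; apply/negP.
split=> //.
have -> : [set x | selfneg g x] = [set z; opp_pt z] :|: porbit g y.
  apply/setP => x; rewrite !inE; apply/idP/idP; first exact: sP.
  case/orP=> [/orP[]/eqP-> // | xy]; first by rewrite selfneg_opp.
  by rewrite (selfneg_porbit cg xy).
rewrite cardsU cards2 eq_sym opp_pt_neq (_ : _ :&: _ = set0) ?cards0 ?subn0 ?addKn //.
apply/setP => x; rewrite !inE; apply/negbTE/andP => -[/orP[]/eqP-> ].
  by apply/negP.
by apply/negP.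
Qed.

(** The positive cycles of g and h are equal as sets, and their negative cycles cover the same
    points with the same two lengths. That the conjugator can also be made to fix [cycle_vec g]
    places it in the parabolic closure, which is needed to correct elements of a normalizer. *)
Lemma cox_type_conj g h : g \in 'C[opp_perm] -> h \in 'C[opp_perm] ->
  cox_type g -> cox_type h -> same_fixed g h ->
  exists2 t, t \in weylD n & g ^ t = h /\ fixes (cycle_vec g) t.
Proof.
move=> cg ch tg th gh; have sgh := same_fixed_selfneg gh.
have pgh := same_fixed_porbit cg ch gh; have [fh fg] := andP gh.
have cv0 x : selfneg g x -> cycle_vec g x = 0%R by rewrite -cycle_vec_eq0 => /eqP.
have fix_t (beta : pt -> pt) t :
    (forall x, if selfneg g x then selfneg g (beta x) else beta x == x) ->
    (forall x, exists b e k, x = flip e ((g ^+ k) b) /\ t x = flip e ((h ^+ k) (beta b))) ->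
    fixes (cycle_vec g) t.
  move=> betaP tP; apply/fixesP => x; have [b [e [k [-> ->]]]] := tP x.
  have flipE u : cycle_vec g (flip e u) = if e then (- cycle_vec g u)%R else cycle_vec g u.
    by case: (e); rewrite /= ?odd_cycle_vec.
  rewrite !flipE !(fixesP _ _ (fixesX _ fh)) !(fixesP _ _ (fixesX _ (fixes_cycle_vec cg))).
  suff -> : cycle_vec g (beta b) = cycle_vec g b by [].
  have := betaP b; case: ifP => [sb sbb|_ /eqP-> //].
  by rewrite !cv0.
case: tg => [ng | [z [y [gz yz ynz sy sP]]]].
  have [|||t ct [gt tP]] := @signed_conj n g h id cg ch.
  - by move=> x; rewrite pgh.
  - by move=> x; rewrite sgh.
  - by move=> x u; rewrite /signed_orbit !pgh.
  have ft : fixes (cycle_vec g) t by apply: fix_t tP => x; rewrite ifN /=.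
  exists t => //; apply/weylDP; split=> //; apply: (fixes_even ct _ ft).
    exact: odd_cycle_vec.
  by move=> x; rewrite cycle_vec_eq0.
case: th => [nh | [z' [y' [gz' yz' ynz' sy' sP']]]].
  by have := nh y; rewrite -sgh sy.
have [[pz pnz] zy nzy sz cy] := cox_type_porbits cg gz yz ynz sy sP.
have [[pz' pnz'] zy' nzy' sz' cy'] := cox_type_porbits ch gz' yz' ynz' sy' sP'.
pose isz x := (x == z) || (x == opp_pt z).
(* Base points on positive cycles stay; the short negative cycle goes to the short one, the other
   negative cycle to the other. *)
pose beta x := if selfneg g x then if isz x then z' else y' else x.
have cS : [set x | selfneg g x] = [set x | selfneg h x].
  by apply/setP => x; rewrite !inE sgh.
have orbz : signed_orbit h z' = [set z'; opp_pt z'] by rewrite /signed_orbit pz' pnz' setUid.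
have orby : signed_orbit h y' = porbit h y'.
  by rewrite /signed_orbit (_ : porbit h (opp_pt y') = porbit h y') ?setUid //; apply/eqP; rewrite eq_porbit_mem.
have syx x : selfneg g x -> ~~ isz x -> porbit g x = porbit g y.
  move=> sx nz; apply/eqP; rewrite eq_porbit_mem.
  by have := sP x sx; rewrite -/(isz x) (negPf nz).
have sbeta x : selfneg h (beta x) = selfneg g x.
  rewrite /beta; case: ifPn => [sx|nx]; last by rewrite -sgh (negPf nx).
  by case: ifP.
have [|||t ct [gt tP]] := @signed_conj n g h beta cg ch.
- move=> x; rewrite /beta; case: ifPn => [sx|nx]; last by rewrite pgh.
  case: ifPn => [/orP[]/eqP-> | nz].
  + by rewrite pz' pz !cards2 !(eq_sym _ (opp_pt _)) !opp_pt_neq.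
  + by rewrite pz' pnz !cards2 !(eq_sym _ (opp_pt _)) !opp_pt_neq.
  by rewrite syx // cy' cy cS.
- exact: sbeta.
- move=> x u ux; have sux : selfneg g u = selfneg g x.
    by rewrite -!sbeta; apply: signed_orbit_selfneg ux.
  move: ux; rewrite /beta -sux; case: (boolP (selfneg g u)) => [su|nu]; last first.
    by rewrite /signed_orbit !pgh ?selfneg_opp // -sux.
  case: (boolP (isz u)) => zu; case: (boolP (isz x)) => zx.
  + move=> _; case/orP: zx => /eqP->; rewrite /signed_orbit ?opp_ptK pz pnz setUid !inE //.
  + by rewrite orby (negPf zy').
  + by rewrite orbz !inE (negPf yz') (negPf ynz').
  by move=> _; rewrite inE (syx x) -?sux // -(syx u) // porbit_id.
have ft : fixes (cycle_vec g) t.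
  apply: fix_t tP => x; rewrite /beta; case: ifP => [sx|->//].
  by rewrite sx; case: ifP => _; rewrite sgh.
have [ot|et] := boolP (odd_perm t); last by exists t => //; apply/weylDP.
(* The sign change at the negative 1-cycle of h commutes with h and has odd parity. *)
exists (t * tperm z' (opp_pt z')).
  apply/weylDP; split; last first.
    by rewrite odd_permM ot odd_tperm eq_sym opp_pt_neq.
  apply/groupM => //; apply/cent1P/commgP/conjg_fixP.
  by rewrite tpermJ !opp_permE opp_ptK tpermC.
split.
  rewrite conjgM gt; apply/conjg_fixP/commgP/commute_sym/commgP/conjg_fixP.
  by rewrite tpermJ perm_opp // gz' opp_ptK tpermC.
apply: fixesM => //; apply/fixesP => x.
have f0 := fixes_selfneg (odd_cycle_vec g) fh.
by case: tpermP => [->|->|//]; rewrite !f0 ?selfneg_opp.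
Qed.

End Conjugacy.

(** A cyclic rotation of the word: s passes d to the end, wraps around to the front and passes u. *)
Lemma conj_rotate (gT : finGroupType) (u c s d : gT) : commute s u -> commute s d ->
  (u * (c * (s * d))) ^ s^-1 = u * (s * (c * d)).
Proof. by move=> su ->; rewrite conjgE invgK !mulgA mulgK su. Qed.

(** * Signed cycle types of Coxeter elements *)

Section CoxeterElements.

Variable n : nat.
Local Notation pt := (signed_pt n).
Local Notation sperm := (signed_perm n).
Local Notation opp_perm := (opp_perm n).
Local Notation opp_ptK := (@opp_ptK n).
Implicit Types (a b x y : pt) (f v : pt -> int) (g h w s t : sperm).

Lemma porbit_conj w t x y : (t y \in porbit (w ^ t) (t x)) = (y \in porbit w x).
Proof.
apply/porbitP/porbitP => -[k e]; exists k; last by rewrite -conjXg permJ e.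
by apply: (@perm_inj _ t); rewrite e -conjXg permJ.
Qed.

Lemma selfneg_conj w t x : t \in 'C[opp_perm] -> selfneg (w ^ t) (t x) = selfneg w x.
Proof. by move=> ct; rewrite /selfneg -perm_opp // porbit_conj. Qed.

Lemma cox_type_conjg w t : t \in 'C[opp_perm] -> cox_type w -> cox_type (w ^ t).
Proof.
move=> ct [nw | [z [y [wz yz ynz sy sP]]]]; [left=> x | right; exists (t z), (t y); split].
- by rewrite -(permKV t x) selfneg_conj.
- by rewrite permJ wz perm_opp.
- by rewrite (inj_eq perm_inj).
- by rewrite -perm_opp // (inj_eq perm_inj).
- by rewrite selfneg_conj.
move=> x; rewrite -(permKV t x) selfneg_conj // -perm_opp // !(inj_eq perm_inj) porbit_conj.
exact: sP.
Qed.

Lemma refl_conj a b w : w \in 'C[opp_perm] -> refl a b ^ w = refl (w a) (w b).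
Proof. by move=> cw; rewrite /refl conjMg !tpermJ !perm_opp. Qed.

Lemma reflCC a b : refl b a = refl a b.
Proof. by rewrite /refl tpermC [tperm (opp_pt b) _]tpermC. Qed.

Lemma coxeter_conj_fixes (L : {set sperm}) c (x : sperm) f : L \subset gensD n ->
  is_coxeter_elt L c -> x \in weylD n -> odd_fun f -> fixes f (c ^ x) ->
  {in <<L>> :^ x, forall w, fixes f w}.
Proof.
move=> sL cL xW fo; rewrite fixes_conj => fc _ /imsetP[w wL ->]; rewrite fixes_conj.
apply: coxeter_fixes sL cL _ fc w wL; apply: odd_fun_comp fo _.
exact: (weylD_even xW).1.
Qed.

Section CoxeterType.

Variables (i0 i1 : 'I_n).
Hypotheses (i0E : i0 = 0%N :> nat) (i1E : i1 = 1%N :> nat).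

Let u := refl (i0, true) (i1, false).
Let s1 := refl (i0, false) (i1, false).

Lemma simple_cases a b : simple a b ->
  [\/ refl a b = u, refl a b = s1 | ~~ a.2 && (0 < a.1)%N].
Proof.
case: a b => [i c] [j d]; rewrite /simple /=; case: d => //; case: c => /=.
  move=> /andP[/eqP i_0 /eqP j_1]; constructor 1.
  have -> : i = i0 by apply: val_inj; rewrite /= i_0 i0E.
  by have -> : j = i1 by apply: val_inj; rewrite /= j_1 i1E.
case: (posnP i) => [i_0 /eqP j_1|_ _]; last by constructor 3.
constructor 2; have -> : i = i0 by apply: val_inj; rewrite /= i_0 i0E.
by have -> : j = i1 by apply: val_inj; rewrite /= j_1 i_0 i1E.
Qed.

Lemma u_s1E x : (u * s1) x = if (x.1 <= 1)%N then opp_pt x else x.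
Proof.
have i01 : (i0 == i1) = false by rewrite -(inj_eq val_inj) /= i0E i1E.
have i10 : (i1 == i0) = false by rewrite eq_sym.
rewrite permM !reflE ?i01 //; case: x => i c; rewrite /opp_pt /=.
have [->|ni0] := eqVneq i i0.
  by rewrite i0E; case: c; rewrite !(xpair_eqE, eqxx, i01, i10).
have [->|ni1] := eqVneq i i1.
  by rewrite i1E; case: c; rewrite !(xpair_eqE, eqxx, i01, i10).
rewrite !xpair_eqE (negPf ni0) (negPf ni1) /= !xpair_eqE (negPf ni0) (negPf ni1) /=.
case: leqP => //; move: ni0 ni1; rewrite -!(inj_eq val_inj) /= i0E i1E; lia.
Qed.
Lemma commute_s1 a b : simple a b -> a = (i1, false) \/ commute s1 (refl a b).
Proof.
move=> sab; have cr := refl_opp (simple_neq sab).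
case: (simple_cases sab) => [-> | -> | /andP[a2]]; last 1 first.
- rewrite leq_eqVlt => /predU1P[a1|a_gt1].
    left; case: a a2 a1 {sab cr} => i [] //= _ i_1; congr (_, _).
    by apply: val_inj; rewrite /= -i_1 i1E.
  right; apply/commgP/conjg_fixP; rewrite refl_conj //.
  have fixed (i : 'I_n) : (i <= 1)%N -> refl a b (i, false) = (i, false).
    move=> i_le1; rewrite reflE ?simple_neq //.
    have b_gt1 : (1 < b.1)%N by case/andP: sab => _; rewrite (negPf a2) => /eqP->; apply: ltnW.
    have ne x : (1 < x.1)%N -> ((i, false) == x) = false.
      by move=> x_gt1; apply/eqP => ix; rewrite -ix /= ltnNge i_le1 in x_gt1.
    by rewrite !ne.
  by rewrite /s1 !fixed ?i0E ?i1E.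
- have i01 : (i0 == i1) = false by rewrite -(inj_eq val_inj) /= i0E i1E.
  have i10 : (i1 == i0) = false by rewrite eq_sym.
  right; apply/commgP/conjg_fixP; rewrite /u refl_conj ?refl_opp /= ?i01 //.
  rewrite !reflE /= ?i01 // /opp_pt /= !(xpair_eqE, eqxx, i01, i10) /=.
  by rewrite [RHS](reflC (a := (i0, false))) ?i01 // reflCC.
- by right.
Qed.

(** A cyclic rotation brings u to the front. The only simple reflection not commuting with s1 occurs
    at most once, so s1 can be moved next to u from one side: directly, or around the end of the
    word. *)
Lemma coxeter_u_s1_first (K : {set sperm}) c : K \subset gensD n -> u \in K -> s1 \in K ->
  is_coxeter_elt K c ->
  exists t r, [/\ t \in weylD n, c ^ t = \prod_(s <- [:: u, s1 & r]) s &
    perm_eq [:: u, s1 & r] (enum K)].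
Proof.
move=> sK uK s1K [s ps ->].
have us1 : u != s1.
  apply/eqP => /permP/(_ (i0, true)); have i01 : (i0 == i1) = false by rewrite -(inj_eq val_inj) /= i0E i1E.
  by rewrite !reflE ?i01 // /opp_pt /= !(xpair_eqE, eqxx, i01).
have in_s r : (r \in s) = (r \in K) by rewrite (perm_mem ps) mem_enum.
have sW (q : seq sperm) : {subset q <= s} -> \prod_(x <- q) x \in weylD n.
  move=> qs; rewrite big_seq; apply: group_prod => x /qs.
  by rewrite in_s => xK; rewrite mem_gen ?(subsetP sK).
have us : uniq s by rewrite (perm_uniq ps) enum_uniq.
have : u \in s by rewrite in_s.
case/splitPr def_s: s / => [A B].
have : s1 \in B ++ A.
  have := in_s s1; rewrite s1K def_s !mem_cat inE eq_sym (negPf us1) /= orbC.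
  by [].
case/splitPr def_BA: (B ++ A) / => [C D].
have psCD : perm_eq [:: u, s1 & C ++ D] s.
  rewrite perm_sym def_s -[u :: B]cat1s perm_catCA /= perm_cons perm_catC def_BA.
  by rewrite -[s1 :: D]cat1s perm_catCA.
have usCD : uniq (C ++ D) by have := perm_uniq psCD; rewrite us /= => /and3P[].
have inCD : {subset C ++ D <= s}.
  by move=> x xCD; rewrite -(perm_mem psCD) !inE xCD !orbT.
have conjA : (\prod_(x <- s) x) ^ (\prod_(x <- A) x) =
    u * (\prod_(x <- C) x * (s1 * \prod_(x <- D) x)).
  have -> : (\prod_(x <- C) x) * (s1 * \prod_(x <- D) x) = \prod_(x <- B ++ A) x.
    by rewrite def_BA big_cat big_cons.
  by rewrite def_s !big_cat big_cons /= conjgE !mulgA mulVg mul1g.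
have AW : \prod_(x <- A) x \in weylD n.
  by apply: sW => x xA; rewrite def_s mem_cat xA.
have cprod (q : seq sperm) : {in q, forall x : sperm, commute s1 x} -> commute s1 (\prod_(x <- q) x).
  by rewrite big_seq => cq; apply: (big_ind (commute s1)) => [||x xq];
    [apply: commute1 | apply: commuteM | apply: cq].
(* A letter of C and a letter of D that both fail to commute with s1 would be the same reflection,
   although the word has no repetition. *)
have : commute s1 (\prod_(x <- C) x) \/ commute s1 (\prod_(x <- D) x).
  have [/allP allC | /allPn[x xC nx]] := boolP (all (fun x : sperm => s1 * x == x * s1) C).
    by left; apply: cprod => x /allC/eqP.
  right; apply: cprod => y yD; apply/eqP/negPn/negP => ny.
  suff exy : x = y.
    move: usCD; rewrite cat_uniq => /and3P[_ /hasPn/(_ y yD)].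
    by rewrite /= -exy xC.
  have /gensDP[a [b [sab ex]]] : x \in gensD n.
    by rewrite (subsetP sK) // -in_s inCD // mem_cat xC.
  have /gensDP[a' [b' [sab' ey]]] : y \in gensD n.
    by rewrite (subsetP sK) // -in_s inCD // mem_cat yD orbT.
  case: (commute_s1 sab) => [ea|]; last by rewrite -ex => /eqP; rewrite (negPf nx).
  case: (commute_s1 sab') => [ea'|]; last by rewrite -ey => /eqP; rewrite (negPf ny).
  rewrite ex ey ea ea'; move: sab sab'; rewrite ea ea' /simple /=.
  case: b b' {ex ey} => [j []] [j' []] //= /eqP ej /eqP ej'.
  by rewrite (_ : j = j') //; apply: val_inj; rewrite /= ej ej'.
have pe r : perm_eq r (C ++ D) -> perm_eq [:: u, s1 & r] (enum K).
  by move=> pr; apply: perm_trans ps; apply: perm_trans psCD; rewrite !perm_cons.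
case=> [Cs1 | Ds1].
  exists (\prod_(x <- A) x), (C ++ D); split=> //; last exact: pe.
  by rewrite -def_s conjA !big_cons big_cat /=; congr (_ * _); rewrite mulgA -Cs1 -mulgA.
exists (\prod_(x <- A) x * s1^-1), (C ++ D); split=> //; last exact: pe.
  by rewrite groupM // groupV mem_gen // (subsetP sK).
have cu : commute s1 u.
  have su : simple (i0, true) (i1, false) by rewrite /simple /= i0E i1E.
  by case: (commute_s1 su).
by rewrite conjgM -def_s conjA !big_cons big_cat /= conj_rotate.
Qed.

(** This and [pos_vec'] are the doubled half-spin weights: nowhere zero, and fixed by every simple
    reflection but [u], respectively [s1]. *)
Definition pos_vec : pt -> int := vec (fun=> 1%R).

Definition pos_vec' : pt -> int := vec (fun i => if i == i0 then -1 else 1)%R.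

Lemma pos_vec_fixes s : s \in gensD n -> s != u -> fixes pos_vec s.
Proof.
move=> /gensDP[a [b [sab ->]]]; rewrite refl_fixes ?simple_neq //; last exact: odd_vec.
move: sab; case: a b => [i c] [j d]; rewrite /simple /pos_vec /vec /=.
case: d => //; case: c => //= /andP[/eqP i_0 /eqP j_1]; case/eqP.
have -> : i = i0 by apply: val_inj; rewrite /= i_0 i0E.
by have -> : j = i1 by apply: val_inj; rewrite /= j_1 i1E.
Qed.

Lemma pos_vec'_fixes s : s \in gensD n -> s != s1 -> fixes pos_vec' s.
Proof.
move=> /gensDP[a [b [sab ->]]]; rewrite refl_fixes ?simple_neq //; last exact: odd_vec.
move: sab; case: a b => [i c] [j d]; rewrite /simple /pos_vec' /vec /=.
have ji0 : (0 < j)%N -> (j == i0) = false.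
  by move=> j_gt0; apply/eqP => ji; rewrite ji i0E in j_gt0.
case: d => //; case: c => /= [/andP[/eqP i_0 /eqP j_1] _ | /eqP j_i].
  have -> : i = i0 by apply: val_inj; rewrite /= i_0 i0E.
  by rewrite eqxx ji0 ?j_1.
have [ii0|_ _] := eqVneq i i0; last by rewrite ji0 ?j_i.
case/eqP; rewrite ii0; have -> : j = i1 by apply: val_inj; rewrite /= j_i ii0 i0E i1E.
by [].
Qed.

Lemma pos_vec_neq0 x : pos_vec x != 0%R.
Proof. by rewrite /pos_vec /vec; case: ifP. Qed.

Lemma pos_vec'_neq0 x : pos_vec' x != 0%R.
Proof. by rewrite /pos_vec' /vec; case: ifP; case: ifP. Qed.

(** If K misses u or s1, then W_K fixes a nowhere zero vector and c has no negative cycle. Otherwise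
    c is conjugate to u s1 b, where u s1 negates the coordinates 0 and 1, while b changes no sign
    and fixes coordinate 0. *)
Lemma coxeter_cox_type (K : {set sperm}) c : K \subset gensD n -> is_coxeter_elt K c ->
  cox_type c.
Proof.
move=> sK cK; have nofix f : odd_fun f -> (forall x, f x != 0%R) ->
    {in K, forall s, fixes f s} -> cox_type c.
  move=> fo fn0 fK; left=> x; apply/negP => sx; have := fn0 x.
  by rewrite (fixes_selfneg fo _ sx) // (fixes_gen fK) // coxeter_gen.
have [uK|nuK] := boolP (u \in K); last first.
  apply: nofix pos_vec_neq0 _ => [|s sinK]; first exact: odd_vec.
  by apply: pos_vec_fixes; [exact: subsetP sinK | apply: contraNneq nuK => <-].
have [s1K|ns1K] := boolP (s1 \in K); last first.
  apply: nofix pos_vec'_neq0 _ => [|s sinK]; first exact: odd_vec.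
  by apply: pos_vec'_fixes; [exact: subsetP sinK | apply: contraNneq ns1K => <-].
have [t [r [tW ct pr]]] := coxeter_u_s1_first sK uK s1K cK.
have [ct_opp _] := weylD_even tW.
suff : cox_type (c ^ t).
  by move/(cox_type_conjg (groupVr ct_opp)); rewrite -conjgM mulgV conjg1.
have cKt : is_coxeter_elt K (c ^ t) by exists [:: u, s1 & r].
move: (c ^ t) ct cKt => c' ct cKt.
have c'W : c' \in weylD n by rewrite (subsetP (gen_sub_weylD sK)) // coxeter_gen.
have [cc' _] := weylD_even c'W.
have [/= /and3P[u_r s1_r _]] : uniq [:: u, s1 & r] by rewrite (perm_uniq pr) enum_uniq.
have in_r s : s \in r -> [/\ s \in gensD n, s != u & s != s1].
  move=> sr; split; first by rewrite (subsetP sK) // -mem_enum -(perm_mem pr) !inE sr !orbT.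
    by apply: contraNneq u_r => <-; rewrite inE sr orbT.
  by apply: contraNneq s1_r => <-.
set b := \prod_(s <- r) s.
have c'E x : c' x = b (if (x.1 <= 1)%N then opp_pt x else x).
  by rewrite ct !big_cons mulgA permM u_s1E.
have b_pos : fixes pos_vec b.
  rewrite /b big_seq; elim/big_ind: _ => [|w1 w2|s /in_r[sS su _]].
  - exact: fixes1.
  - exact: fixesM.
  - exact: pos_vec_fixes.
have b_fix e : b (i0, e) = (i0, e).
  rewrite /b big_seq; elim/big_ind: _ => [|w1 w2 e1 e2|s /in_r[]].
  - by rewrite perm1.
  - by rewrite permM e1.
  case/gensDP=> [a [a' [saa' ->]]] nu ns1.
  have [e' | e' | /andP[na2 a_gt0]] := simple_cases saa'; first by rewrite e' eqxx in nu.
    by rewrite e' eqxx in ns1.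
  have a'_gt0 : (0 < a'.1)%N by case/andP: saa' => _; rewrite (negPf na2) => /eqP->.
  have ne x : (0 < x.1)%N -> ((i0, e) == x) = false.
    by move=> x_gt0; apply/eqP => ix; rewrite -ix /= i0E in x_gt0.
  by rewrite reflE ?simple_neq // !ne.
have i10 : (i1 == i0) = false by rewrite -(inj_eq val_inj) /= i0E i1E.
pose z : pt := (i0, false); pose y : pt := (i1, false).
have c'z e : c' (i0, e) = opp_pt (i0, e) by rewrite c'E /= i0E b_fix.
have cv := fixes_cycle_vec cc'.
(* A vector fixed by [c'] is fixed by u and s1, so its value at i1 equals both its value at i0 and
   the opposite; [cycle_vec c'] therefore vanishes at y, which happens only on negative cycles. *)
have sy : selfneg c' y.
  have cvK : {in K, forall s, fixes (cycle_vec c') s}.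
    move=> s sinK; apply: (coxeter_fixes sK cKt) => //; first exact: odd_cycle_vec.
    exact: mem_gen.
  have i01 : (i0, true).1 != (i1, false).1 by rewrite /= eq_sym i10.
  have := cvK _ uK; have := cvK _ s1K; rewrite /u /s1.
  rewrite !refl_fixes //; try exact: odd_cycle_vec.
  rewrite -[(i0, true)]/(opp_pt (i0, false)) odd_cycle_vec => /eqP-> /eqP e.
  by rewrite -cycle_vec_eq0; move/eqP: e; rewrite eq_sym -addr_eq0 -mulr2n mulrn_eq0.
right; exists z, y; split=> //.
- exact: c'z.
- by rewrite xpair_eqE i10.
- by rewrite /opp_pt xpair_eqE i10.
move=> x sx; apply: contraLR sx; rewrite !negb_or => /andP[/andP[xz xnz] xy].
have z_k e k : (c' ^+ k) (i0, e) \in [:: z; opp_pt z].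
  elim: k => [|k]; first by rewrite perm1 !inE; case: (e); rewrite eqxx ?orbT.
  rewrite expgSr permM !inE => /orP[]/eqP->; rewrite ?perm_opp // (c'z false : c' z = _).
    by rewrite eqxx orbT.
  by rewrite opp_ptK eqxx.
(* The cycle of x avoids the coordinates 0 and 1, so [c'] acts on it as b and never changes a
   sign. *)
have high k : (1 < ((c' ^+ k) x).1)%N.
  rewrite ltnNge leq_eqVlt ltnS leqn0; apply/negP => /orP[]/eqP.
    rewrite -i1E => /val_inj e.
    case/negP: xy; rewrite -eq_porbit_mem -(porbit_perm c' k) eq_porbit_mem.
    by case: ((c' ^+ k) x) e => i [] /= ->; [exact: sy | exact: porbit_id].
  rewrite -i0E => /val_inj e.
  have /porbitP[l ex] : x \in porbit c' ((c' ^+ k) x) by rewrite porbit_perm porbit_id.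
  rewrite [(c' ^+ k) x]surjective_pairing e in ex.
  by have := z_k ((c' ^+ k) x).2 l; rewrite -ex !inE (negPf xz) (negPf xnz).
have pow k : (c' ^+ k) x = (b ^+ k) x.
  elim: k => [|k IHk]; first by rewrite !perm1.
  by rewrite !expgSr !permM -IHk c'E leqNgt high.
apply/negP => /porbitP[k]; rewrite pow => e.
have := fixesP _ _ (fixesX k b_pos) x; rewrite -e.
by rewrite /pos_vec /vec /=; case: (x.2).
Qed.

End CoxeterType.

Hypothesis n_gt1 : (1 < n)%N.

Lemma coxeter_elt_cox_type (K : {set sperm}) c : K \subset gensD n -> is_coxeter_elt K c ->
  cox_type c.
Proof.
pose i0 := Ordinal (ltnW n_gt1); pose i1 := Ordinal n_gt1.
exact: (@coxeter_cox_type i0 i1).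
Qed.

Lemma coxeter_elt_conj (K L : {set sperm}) c d (x : sperm) :
  K \subset gensD n -> L \subset gensD n -> is_coxeter_elt K c -> is_coxeter_elt L d ->
  x \in weylD n -> <<K>> = <<L>> :^ x -> exists2 t, t \in weylD n & d ^ t = c.
Proof.
move=> sK sL cK dL xW eKL.
have [cx _] := weylD_even xW.
have [cd _] := weylD_even (subsetP (gen_sub_weylD sL) _ (coxeter_gen dL)).
have [cc _] := weylD_even (subsetP (gen_sub_weylD sK) _ (coxeter_gen cK)).
have cdx : d ^ x \in 'C[opp_perm] by rewrite groupJ.
have [||t tW [et _]] := cox_type_conj cdx cc _ (coxeter_elt_cox_type sK cK).
- by apply: cox_type_conjg => //; apply: coxeter_elt_cox_type dL.
- apply/andP; split.
    apply: (coxeter_conj_fixes sL dL xW (odd_cycle_vec _) (fixes_cycle_vec cdx)).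
    by rewrite -eKL coxeter_gen.
  apply: (coxeter_fixes sK cK (odd_cycle_vec _) (fixes_cycle_vec cc)).
  by rewrite eKL memJ_conjg coxeter_gen.
by exists (x * t); rewrite ?groupM // conjgM.
Qed.

(** Moving [cycle_vec g] into the dominant chamber shows that the parabolic closure of g is
    conjugate to a standard W_K; the corresponding conjugate of a Coxeter element of W_K has the
    same fixed vectors as g. *)
Lemma cox_type_parabolic g : g \in weylD n -> cox_type g ->
  exists (K : {set sperm}) (x : sperm), [/\ K \subset gensD n, x \in weylD n,
    {in weylD n, forall w, (w \in <<K>> :^ x) = fixes (cycle_vec g) w} &
    forall c, is_coxeter_elt K c -> exists2 t, t \in weylD n & c ^ t = g].
Proof.
move=> gW tg; have [cg _] := weylD_even gW; have vo := odd_cycle_vec g.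
have [m mW mdom] := exists_dominant_gen (subxx _) vo.
have [cm _] := weylD_even mW.
pose f := cycle_vec g \o m; have fo : odd_fun f by apply: odd_fun_comp.
have fd : dominant f.
  by move=> a b sab; apply: mdom => //; apply/gensDP; exists a, b.
have sK : simple_fixer f \subset gensD n by apply/subsetP => s; rewrite inE => /andP[].
have inK : {in weylD n, forall w, (w \in <<simple_fixer f>> :^ m) = fixes (cycle_vec g) w}.
  move=> w wW; rewrite mem_conjg dominant_fixerE //; last by rewrite groupJ ?groupV.
  by rewrite -fixes_conj conjgKV.
exists (simple_fixer f), m; split=> // c cK.
have cW := subsetP (gen_sub_weylD sK) _ (coxeter_gen cK); have [cc _] := weylD_even cW.
have ccm : c ^ m \in 'C[opp_perm] by rewrite groupJ.
have [||t tW [et _]] := cox_type_conj ccm cg _ tg.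
- by apply: cox_type_conjg => //; apply: coxeter_elt_cox_type cK.
- apply/andP; split; last first.
    by rewrite -inK; [rewrite memJ_conjg coxeter_gen | exact: groupJ].
  apply: (coxeter_conj_fixes sK cK mW (odd_cycle_vec _) (fixes_cycle_vec ccm)).
  by rewrite inK // fixes_cycle_vec.
by exists (m * t); rewrite ?groupM // conjgM.
Qed.

End CoxeterElements.

(** * Fixed cosets *)

(** Inversion turns left multiplication by N into the right translation action, whose orbits all
    have size |N|. *)
Lemma dvdn_card_mul_closed (gT : finGroupType) (N : {group gT}) (T : {set gT}) :
  {in N & T, forall a x, a * x \in T} -> #|N| %| #|T|.
Proof.
move=> clT; have actsN : [acts N, on T^-1 | 'R].
  apply/actsP => a aN x; rewrite !mem_invg invMg; apply/idP/idP => Tx.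
    by rewrite -(mulKVg a x^-1) clT.
  by rewrite clT ?groupV.
have -> : #|T| = \sum_(X in [set orbit 'R%act N x | x in T^-1]) #|X|.
  by rewrite (acts_sum_card_orbit actsN) card_invg.
by apply: dvdn_sum => _ /imsetP[x _ ->]; rewrite orbitR card_lcoset.
Qed.

Section FixedCosets.

Variables (gT : finGroupType) (W G : {group gT}).
Hypothesis sGW : G \subset W.
Implicit Types (A B : {set gT}) (g t x : gT).

Definition fixed_cosets A := 'Fix_(rcosets G W | 'Rs)(A).

Lemma fixed_cosetsP A H :
  reflect (exists x, [/\ x \in W, A \subset G :^ x & H = G :* x]) (H \in fixed_cosets A).
Proof.
apply: (iffP setIP) => [[/rcosetsP[x xW ->]] | [x [xW sAG ->]]].
  by rewrite sub_afixRs_norms; exists x.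
by rewrite mem_rcosets mulSGid // sub_afixRs_norms.
Qed.

Lemma mem_fixed_cosets A x : x \in W -> (G :* x \in fixed_cosets A) = (A \subset G :^ x).
Proof. by move=> xW; rewrite inE mem_rcosets mulSGid // xW sub_afixRs_norms. Qed.

Definition transporter A := [set x in W | A \subset G :^ x].

Lemma card_transporter A : #|transporter A| = (#|fixed_cosets A| * #|G|)%N.
Proof.
have sub : fixed_cosets A \subset rcosets G W by apply: subsetIl.
have /and3P[_ triv nz] := rcosets_partition sGW.
rewrite -(@card_uniform_partition _ #|G| (fixed_cosets A) (transporter A)) //.
  by move=> H /(subsetP sub)/rcosetsP[x _ ->]; rewrite card_rcoset.
apply/and3P; split; last by apply: contra nz; apply: subsetP.
  apply/eqP/setP => x; apply/bigcupP/idP => [[H /fixed_cosetsP[y [yW sAG ->]]]|].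
    case/rcosetP => z zG ->; rewrite inE groupM ?(subsetP sGW _ zG) //=.
    by rewrite conjsgM (conjGid zG).
  by case/setIdP=> xW sAG; exists (G :* x); rewrite ?mem_fixed_cosets ?rcoset_refl.
exact: trivIsetS triv.
Qed.

(** The normalizer multiplies the transporter of A into conjugates of G freely from the left. So
    each diagonal mark divides its whole row. *)
Lemma index_dvd_fixed_cosets A : #|'N_W(G) : G| %| #|fixed_cosets A|.
Proof.
rewrite -(@dvdn_pmul2r #|G|) // -card_transporter mulnC Lagrange ?subsetI ?sGW ?normG //.
apply: dvdn_card_mul_closed => a x /setIP[aW aN] /setIdP[xW sAG].
by rewrite inE groupM //= conjsgM (normP aN).
Qed.

Lemma fixed_cosets_self : #|fixed_cosets G| = #|'N_W(G) : G|.
Proof. by rewrite /fixed_cosets afixRs_rcosets. Qed.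

Lemma fixed_cosets_neq0 A : #|fixed_cosets A| != 0%N -> exists2 x, x \in W & A \subset G :^ x.
Proof.
by rewrite -lt0n => /card_gt0P[H /fixed_cosetsP[x [xW sAG _]]]; exists x.
Qed.

Lemma card_fixed_cosetsJ A t : t \in W -> #|fixed_cosets (A :^ t)| = #|fixed_cosets A|.
Proof.
move=> tW; have inj : injective (fun H : {set gT} => H :* t).
  by move=> H1 H2 /(congr1 (fun H => H :* t^-1)); rewrite -!rcosetM mulgV !mulg1.
rewrite -[RHS](card_imset _ inj); apply: eq_card => H; apply/fixed_cosetsP/imsetP.
  move=> [x [xW sAG ->]]; exists (G :* (x * t^-1)); last by rewrite -rcosetM mulgKV.
  by rewrite mem_fixed_cosets ?groupM ?groupV // conjsgM -sub_conjg.
move=> [_ /fixed_cosetsP[x [xW sAG ->]] ->]; exists (x * t).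
by rewrite groupM // conjsgM conjSg rcosetM.
Qed.

(** P permutes the cosets fixed by A. This serves to drop the p-part of a Coxeter element and, for p
    = 2, with P generated by a sign change. *)
Lemma fixed_cosets_mod (p : nat) (P : {group gT}) (A : {set gT}) : p.-group P -> P \subset W ->
  P \subset 'N(A) -> #|fixed_cosets A| = #|fixed_cosets (A :|: P)| %[mod p].
Proof.
move=> pP sPW nAP.
have actsP : [acts P, on fixed_cosets A | 'Rs].
  apply/actsP => a aP H; apply/fixed_cosetsP/fixed_cosetsP => -[x [xW sAG eH]]; last first.
    exists (x * a); rewrite groupM ?(subsetP sPW _ aP) // conjsgM.
    split=> //; first by rewrite -[A](normP (subsetP nAP a aP)) conjSg.
    by rewrite eH /= rcosetM rcosetE.
  exists (x * a^-1); rewrite groupM ?groupV ?(subsetP sPW _ aP) // conjsgM.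
  rewrite -sub_conjg (normP (subsetP nAP a aP)); split=> //.
  by rewrite rcosetM -eH /= rcosetE -rcosetM mulgV mulg1.
rewrite (pgroup_fix_mod pP actsP); congr (_ %% _); apply: eq_card => H.
apply/setIP/fixed_cosetsP => [[/fixed_cosetsP[x [xW sAG ->]]]|[x [xW]]].
  by rewrite sub_afixRs_norms => sPG; exists x; rewrite subUset sAG.
by rewrite subUset => /andP[sAG sPG ->]; rewrite sub_afixRs_norms mem_fixed_cosets.
Qed.

Lemma fixed_cosets_p'part (p : nat) g : g \in W ->
  #|fixed_cosets <[g]>| = #|fixed_cosets <[g.`_p^']>| %[mod p].
Proof.
move=> gW; have cyc : <[g.`_p]> \subset 'N(<[g.`_p^']>).
  rewrite cents_norm // cent_cycle cycle_subG; apply/cent1P.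
  by rewrite /constt; apply: commuteX2.
rewrite [in RHS](@fixed_cosets_mod p <[g.`_p]>%G) //=; last 2 first.
- exact: p_elt_constt.
- by rewrite cycle_subG groupX.
congr (_ %% _); apply: eq_card => H; apply/fixed_cosetsP/fixed_cosetsP.
  move=> [x [xW sgG ->]]; exists x; split=> //; rewrite subUset !cycle_subG.
  by rewrite !groupX // -cycle_subG.
move=> [x [xW + ->]]; rewrite subUset !cycle_subG => /andP[g1 g2]; exists x.
by split=> //; rewrite cycle_subG -(consttC p g) groupM.
Qed.

End FixedCosets.

(** * Merging p cycles *)

Lemma permXS (T : finType) (w : {perm T}) k x : (w ^+ k.+1) x = w ((w ^+ k) x).
Proof. by rewrite expgSr permM. Qed.

Lemma permXD (T : finType) (w : {perm T}) j k x : (w ^+ (j + k)) x = (w ^+ k) ((w ^+ j) x).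
Proof. by rewrite expgD permM. Qed.

Lemma restr_permEif (T : finType) (R : {set T}) (w : {perm T}) x :
  (forall y, (w y \in R) = (y \in R)) -> restr_perm R w x = if x \in R then w x else x.
Proof.
move=> wR; have wN : w \in 'N(R | 'P) by apply/astabsP.
case: ifPn => [xR|]; first by rewrite restr_permE.
exact: out_perm (restr_perm_on _ _).
Qed.

Lemma commute_restr_perm (T : finType) (R : {set T}) (w t : {perm T}) :
  (forall y, (w y \in R) = (y \in R)) -> (forall y, (t y \in R) = (y \in R)) ->
  commute t w -> commute t (restr_perm R w).
Proof.
move=> wR tR tw; apply/permP => x; rewrite !permM !restr_permEif // tR.
by case: ifP => // _; rewrite -!permM tw.
Qed.

Section Merging.

Variable n : nat.
Local Notation pt := (signed_pt n).
Local Notation sperm := (signed_perm n).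
Local Notation opp_perm := (opp_perm n).
Local Notation opp_ptK := (@opp_ptK n).
Implicit Types (a b x y : pt) (f v : pt -> int) (g h w s t : sperm).

Section Merge.

Variables (p : nat) (g t : sperm) (x0 : pt).
Hypotheses (p_prime : prime p) (p_odd : odd p).
Hypotheses (cg : g \in 'C[opp_perm]) (ct : t \in 'C[opp_perm]) (gt : commute g t).
Local Notation v := (cycle_vec g).
Hypotheses (vtp : fixes v (t ^+ p)) (vtx0 : v (t x0) != v x0) (tg : cox_type g).

Let vo : odd_fun v := @odd_cycle_vec n g.

Lemma selfneg_commute w x : w \in 'C[opp_perm] -> commute g w ->
  selfneg g (w x) = selfneg g x.
Proof.
move=> cw gw; have gwE : g ^ w = g by apply/conjg_fixP/commgP.
by rewrite -{1}gwE selfneg_conj.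
Qed.

(** An element commuting with g permutes the cycles of g and preserves their signs, so it acts on
    the values of v, including the value 0 shared by all negative cycles. *)
Lemma cycle_vec_commute w x y : w \in 'C[opp_perm] -> commute g w ->
  v x = v y -> v (w x) = v (w y).
Proof.
move=> cw gw exy; have gwE : g ^ w = g by apply/conjg_fixP/commgP.
have [sy|ny] := boolP (selfneg g y).
  have sx : selfneg g x by rewrite -cycle_vec_eq0 exy cycle_vec_eq0.
  by rewrite !(fixes_selfneg vo (fixes_cycle_vec cg)) ?selfneg_commute.
apply: (fixes_porbit (fixes_cycle_vec cg)).
by rewrite -{1}gwE porbit_conj -cycle_vec_inj // exy.
Qed.

Let ctX k : t ^+ k \in 'C[opp_perm]. Proof. exact: groupX. Qed.
Let gtX k : commute g (t ^+ k). Proof. exact: commuteX. Qed.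

Let a k : int := v ((t ^+ k) x0).
Let inA k x := (v x == a k) || (v x == - a k)%R.

Let a_neq0 k : a k != 0%R.
Proof.
rewrite cycle_vec_eq0 selfneg_commute //; apply: contraNN vtx0 => s0.
by rewrite !(fixes_selfneg vo (fixes_cycle_vec cg)) // selfneg_commute.
Qed.

Let aDp k : a (k + p) = a k.
Proof. by rewrite /a expgD permM (fixesP _ _ vtp). Qed.

Let inA_t j k x : inA j x -> inA (j + k) ((t ^+ k) x).
Proof.
rewrite /inA /a expgD permM => /orP[]/eqP e.
  by rewrite (cycle_vec_commute (ctX k) (gtX k) e) eqxx.
rewrite -vo in e; rewrite (cycle_vec_commute (ctX k) (gtX k) e).
by rewrite perm_opp // vo eqxx orbT.
Qed.

Let inA_opp j x : inA j (opp_pt x) = inA j x.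
Proof. by rewrite /inA vo eqr_opp eqr_oppLR orbC. Qed.

Let inA_fix j w x : fixes v w -> inA j (w x) = inA j x.
Proof. by move=> /fixesP fw; rewrite /inA fw. Qed.

(* As p is odd, a power of t fixing the cycle of x0 up to sign forces t to fix it. *)
Let inA_0 i : (0 < i < p)%N -> ~~ inA 0 ((t ^+ i) x0).
Proof.
move=> /andP[i_gt0 i_lt]; apply/negP => ix; have i2 : v ((t ^+ (i + i)) x0) = v x0.
  rewrite expgD permM; move: (ix); rewrite /inA /a expg0 perm1 => /orP[]/eqP e.
    by rewrite (cycle_vec_commute (ctX i) (gtX i) e).
  have e' : v ((t ^+ i) x0) = v (opp_pt x0) by rewrite vo.
  by rewrite (cycle_vec_commute (ctX i) (gtX i) e') perm_opp // vo e opprK.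
have i2k k : v ((t ^+ ((i + i) * k)) x0) = v x0.
  elim: k => [|k IHk]; first by rewrite muln0 perm1.
  by rewrite mulnS expgD permM (cycle_vec_commute (ctX _) (gtX _) i2).
(* Since p is odd, 2i is invertible modulo p, and a suitable power of [t ^+ (i + i)] acts on values
   as t itself. *)
have cop : coprime (i + i) p.
  rewrite addnn -mul2n coprimeMl coprime2n p_odd coprime_sym prime_coprime //.
  by rewrite gtnNdvd.
have [|[k l] /= kl] := coprimeP _ _ cop; first by rewrite addn_gt0 i_gt0.
have {}kl : ((i + i) * k = 1 + p * l)%N by move: kl; lia.
have := i2k k; rewrite kl expgD permM expg1 expgM (fixesP _ _ (fixesX l vtp)) => /eqP.
by rewrite (negPf vtx0).
Qed.

Let p_gt0 : (0 < p)%N. Proof. exact: prime_gt0. Qed.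

Let inA_inj j k x : (j < p)%N -> (k < p)%N -> inA j x -> inA k x -> j = k.
Proof.
wlog lt_jk : j k / (j < k)%N.
  by move=> wl j_lt k_lt jx kx; case: (ltngtP j k) => // lt; [|symmetry]; apply: wl lt _ _ _ _.
move=> j_lt k_lt /(inA_t (p - k)) jx /(inA_t (p - k)).
rewrite subnKC 1?ltnW // -[p in inA p]add0n.
set y := (t ^+ _) x in jx *; move=> ky; exfalso.
have [|] := negP (@inA_0 (j + (p - k)) _); first by lia.
move: jx ky; rewrite /inA aDp -!/(a _) => /orP[]/eqP-> /orP[]/eqP e.
- by rewrite /a in e *; rewrite e eqxx.
- by rewrite /a in e *; rewrite e eqxx orbT.
- by rewrite /a in e *; rewrite -eqr_oppLR e eqxx orbT.
by move/oppr_inj: e; rewrite /a => ->; rewrite eqxx.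
Qed.

(** [U] is the union of the p cycles to be merged and of their opposites; [L] is the last pair,
    where a turn closes. *)
Let U := [set x | [exists j : 'I_p, inA j x]].
Let L := [set x | inA p.-1 x].

Let UP x : reflect (exists2 j, (j < p)%N & inA j x) (x \in U).
Proof.
rewrite inE; apply: (iffP existsP) => [[j jx] | [j j_lt jx]]; first by exists j.
by exists (Ordinal j_lt).
Qed.

Let LU x : x \in L -> x \in U.
Proof. by rewrite inE => xL; apply/UP; exists p.-1; rewrite ?prednK. Qed.

Let U_fix w x : fixes v w -> (w x \in U) = (x \in U).
Proof. by move=> fw; rewrite !inE; apply: eq_existsb => j; apply: inA_fix. Qed.

Let U_opp x : (opp_pt x \in U) = (x \in U).
Proof. by rewrite !inE; apply: eq_existsb => j; apply: inA_opp. Qed.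

Let L_fix w x : fixes v w -> (w x \in L) = (x \in L).
Proof. by move=> fw; rewrite !inE inA_fix. Qed.

Let L_opp x : (opp_pt x \in L) = (x \in L).
Proof. by rewrite !inE inA_opp. Qed.

Let inA_t1 j x : (j < p)%N -> inA j x -> inA (if j == p.-1 then 0%N else j.+1) (t x).
Proof.
move=> j_lt /(inA_t 1); rewrite expg1 addn1; case: eqP => // ->; rewrite prednK //.
by rewrite /inA -[p]add0n aDp.
Qed.

Let U_t x : (t x \in U) = (x \in U).
Proof.
have tU y : y \in U -> t y \in U.
  case/UP => j j_lt /(inA_t1 j_lt) jy; apply/UP; eexists; last exact: jy.
  by case: eqP => //; lia.
apply/idP/idP => [tx|]; last exact: tU.
have tkU k : (t ^+ k) (t x) \in U.
  by elim: k => [|k IHk]; rewrite ?perm1 // expgSr permM tU.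
by have := tkU p.-1; rewrite -permM -expgS prednK // U_fix.
Qed.

Let gp := g.`_p.
Let gp' := g.`_p^'.

Let vg : fixes v g := fixes_cycle_vec cg.
Let vgp : fixes v gp. Proof. exact: fixesX. Qed.
Let vgp' : fixes v gp'. Proof. exact: fixesX. Qed.
Let cgp : gp \in 'C[opp_perm]. Proof. exact: groupX. Qed.
Let cgp' : gp' \in 'C[opp_perm]. Proof. exact: groupX. Qed.

(** The factor [(t ^+ p)^-1] cancels the p steps by t that make up a turn, which leaves exactly the
    p-part of g. *)
Let loop := gp * (t ^+ p)^-1.
Let vloop : fixes v loop. Proof. by rewrite fixesM ?fixesV. Qed.

(* On the p cycles of U and their opposites, merger acts as t, except that the p-part of
   g is inserted once per turn; hence its p-th power is the p-part of g there. *)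
Definition merger := restr_perm L loop * restr_perm (~: U) gp * restr_perm U t.
Local Notation kappa := merger.

Let kappaE x : kappa x = if x \in L then t (loop x) else if x \in U then t x else gp x.
Proof.
rewrite /merger !permM (restr_permEif _ U_t).
rewrite [restr_perm (~: U) _ _]restr_permEif; last by move=> y; rewrite !in_setC U_fix.
rewrite restr_permEif; last by move=> y; apply: L_fix.
rewrite in_setC; case: (boolP (x \in L)) => xL; first by rewrite U_fix // (LU xL) /= U_fix // (LU xL) /loop permM.
by case: (boolP (x \in U)) => xU; rewrite /= ?xU //= U_fix // (negPf xU).
Qed.

Let kappa_commute w : commute w loop -> commute w gp -> commute w t ->
  (forall x, (w x \in U) = (x \in U)) -> (forall x, (w x \in L) = (x \in L)) ->
  commute w kappa.
Proof.
move=> wl wgp wt wU wL; apply: commuteM; first apply: commuteM.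
- by apply: commute_restr_perm => // y; apply: L_fix.
- by apply: commute_restr_perm => // y; rewrite !in_setC ?wU ?U_fix.
by apply: commute_restr_perm => // y; apply: U_t.
Qed.

Let cggp : commute g gp. Proof. exact: commuteX. Qed.
Let ctgp : commute t gp. Proof. by apply: commuteX; apply: commute_sym. Qed.
Let ctgp' : commute t gp'. Proof. by apply: commuteX; apply: commute_sym. Qed.
Let cgpgp' : commute gp' gp. Proof. exact: commuteX2. Qed.

Let commute_loop w : commute w gp -> commute w t -> commute w loop.
Proof. by move=> wgp wt; apply: commuteM => //; apply: commuteV; apply: commuteX. Qed.

Lemma merger_opp : kappa \in 'C[opp_perm].
Proof.
have opp_comm w : w \in 'C[opp_perm] -> commute opp_perm w by move/cent1P/commute_sym.
apply/cent1P/commute_sym; apply: kappa_commute; try exact: opp_comm.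
- by apply: commute_loop; apply: opp_comm.
- by move=> x; rewrite opp_permE U_opp.
- by move=> x; rewrite opp_permE L_opp.
Qed.

Let gp'_kappa : commute gp' kappa.
Proof.
have gt' : commute gp' t by apply: commute_sym.
apply: kappa_commute => //; first exact: commute_loop.
  by move=> x; apply: U_fix.
by move=> x; apply: L_fix.
Qed.

Let kappaX_U j k x : (j + k < p)%N -> inA j x -> (kappa ^+ k) x = (t ^+ k) x.
Proof.
move=> jk jx; elim: k jk => [|k IHk] jk; first by rewrite !perm1.
rewrite addnS in jk; rewrite !permXS IHk ?(ltnW jk) //.
have jkx : inA (j + k) ((t ^+ k) x) by apply: inA_t.
rewrite kappaE ifN; last first.
  rewrite inE; apply/negP => jkx'; move: (jk).
  by rewrite (inA_inj (ltnW jk) _ jkx jkx') ?prednK ?ltnn.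
by rewrite ifT //; apply/UP; exists (j + k)%N => //; apply: ltnW.
Qed.

Let kappaXp_U x : x \in U -> (kappa ^+ p) x = gp x.
Proof.
case/UP => j j_lt jx; have le_j : (j <= p.-1)%N by rewrite -ltnS prednK.
(* From index j, it takes [p.-1 - j] plain steps to reach [L], one step through [loop] to index 0,
   and j plain steps back to index j. *)
have -> : p = ((p.-1 - j).+1 + j)%N by rewrite addSn subnK ?prednK.
rewrite permXD permXS (kappaX_U _ jx); last by rewrite subnKC // prednK.
have := inA_t (p.-1 - j) jx; rewrite subnKC //.
move=> yL; rewrite kappaE inE yL.
have y0 : inA 0 (t (loop ((t ^+ (p.-1 - j)) x))).
  have := inA_t1 _ (_ : inA p.-1 (loop ((t ^+ (p.-1 - j)) x))).
  by rewrite eqxx; apply; rewrite ?prednK // inA_fix.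
rewrite (kappaX_U _ y0) ?add0n //.
have -> : (t ^+ j) (t (loop ((t ^+ (p.-1 - j)) x))) =
    (t ^+ (p.-1 - j) * gp * (t ^+ p)^-1 * t * t ^+ j) x by rewrite !permM.
suff -> : t ^+ (p.-1 - j) * gp * (t ^+ p)^-1 * t * t ^+ j = gp by [].
have tj : commute (t ^+ (p.-1 - j)) gp.
  by apply: commute_sym; apply: commuteX; apply: commute_sym.
rewrite tj -!mulgA -[RHS]mulg1; congr (_ * _).
rewrite [t * _](_ : _ = t ^+ j.+1) ?expgS // [_^-1 * _](_ : _ = t ^+ j.+1 * (t ^+ p)^-1).
  by rewrite mulgA -expgD addnS subnK // prednK // mulgV.
rewrite -expgS; exact: (commute_sym (commuteV (commuteX2 _ _ (commute_refl t)))).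
Qed.

Lemma merger_p_elt : p.-elt kappa.
Proof.
have kU x : (kappa x \in U) = (x \in U).
  rewrite kappaE; case: ifP => [xL|_]; first by rewrite U_t U_fix.
  by case: ifP => xU; rewrite ?U_t ?U_fix // xU.
have kXU k x : ((kappa ^+ k) x \in U) = (x \in U).
  by elim: k => [|k IHk]; rewrite ?perm1 // permXS kU.
have k1 : kappa ^+ (p * #[gp]) = 1.
  apply/permP => x; rewrite perm1.
  have [xU|nxU] := boolP (x \in U).
    have kpX k : (kappa ^+ (p * k)) x = (gp ^+ k) x.
      elim: k => [|k IHk]; first by rewrite muln0.
      rewrite mulnS addnC permXD kappaXp_U; first by rewrite IHk permXS.
      by rewrite kXU.
    by rewrite kpX expg_order perm1.
  have kX k : (kappa ^+ k) x = (gp ^+ k) x.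
    elim: k => [|k IHk]; rewrite ?perm1 // !permXS -IHk kappaE ifN ?ifN ?kXU //.
    by apply: contra nxU => /LU; rewrite kXU.
  by rewrite kX mulnC expgM expg_order expg1n perm1.
apply: (@pnat_dvd _ (p * #[gp])); first by rewrite order_dvdn k1.
by rewrite pnatM pnat_id //; exact: p_elt_constt.
Qed.

Definition merged := gp' * kappa.
Local Notation g' := merged.

Lemma merged_p'part : g'.`_p^' = g.`_p^'.
Proof.
have k1 : kappa.`_p^' = 1 by apply/constt1P; rewrite /p_elt pnatNK; exact: merger_p_elt.
by rewrite consttM // (constt_p_elt (p_elt_constt _ _)) k1 mulg1.
Qed.

Lemma merged_ppart : g'.`_p = kappa.
Proof.
have g1 : gp'.`_p = 1 by apply/constt1P; exact: p_elt_constt.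
by rewrite consttM // (constt_p_elt merger_p_elt) g1 mul1g.
Qed.

Lemma merged_opp : g' \in 'C[opp_perm].
Proof. by rewrite groupM ?merger_opp. Qed.

(** The p-part of g is locally a power of the merger: its p-th power on U, itself elsewhere. So the
    parabolic closure of [g'] contains that of g. *)
Lemma merged_fixes f : fixes f g' -> fixes f g.
Proof.
move=> fg'; have fk : fixes f kappa by rewrite -merged_ppart fixesX.
have fgp' : fixes f gp' by rewrite /gp' -merged_p'part fixesX.
rewrite -(consttC p g) fixesM //; apply/fixesP => x.
have [xU|nxU] := boolP (x \in U).
  by rewrite -kappaXp_U // (fixesP _ _ (fixesX _ fk)).
rewrite -[in RHS](fixesP _ _ fk) kappaE ifN ?ifN //.
by apply: contra nxU; apply: LU.
Qed.

(** This makes the enlargement strict: [g'] maps the cycle of x0 to that of [t x0]. *)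
Lemma merged_not_fixes : ~~ fixes v g'.
Proof.
apply: contra vtx0 => /fixesP/(_ x0); rewrite permM => <-.
have a0 : inA 0 (gp' x0) by rewrite inA_fix // /inA /a perm1 eqxx.
rewrite kappaE ifN; last first.
  rewrite inE; apply/negP => aL; have := prime_gt1 p_prime.
  by rewrite -(prednK p_gt0) -(inA_inj _ _ a0 aL) // prednK.
rewrite ifT; last by apply/UP; exists 0%N.
by apply/eqP/cycle_vec_commute => //; rewrite (fixesP _ _ vgp').
Qed.

Let g'_out x k : x \notin U -> (g' ^+ k) x = (g ^+ k) x.
Proof.
move=> nxU; elim: k => [|k IHk]; rewrite ?perm1 // !permXS IHk /merged permM.
have nU : gp' ((g ^+ k) x) \notin U by rewrite (U_fix _ vgp') (U_fix _ (fixesX k vg)).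
rewrite kappaE ifN ?ifN //; last by apply: contra nU; apply: LU.
by rewrite -permM cgpgp' consttC.
Qed.

Let porbit_out x : x \notin U -> porbit g' x = porbit g x.
Proof.
by move=> nxU; apply/setP => y; apply/porbitP/porbitP => -[k ->]; exists k; rewrite g'_out.
Qed.

(** It selects from each opposite pair in U the cycle of a [(t ^+ j) x0]. This half is stable under
    [g'] and disjoint from its opposite, so U carries no negative cycle of [g']. *)
Let mark_pos x : bool := [exists j : 'I_p, v x == a j].

Let mark_pos_opp x : mark_pos x -> ~~ mark_pos (opp_pt x).
Proof.
move=> /existsP[j jx]; apply/existsP => -[k]; rewrite vo => kx.
have jk : j = k :> nat.
  apply: (@inA_inj _ _ x) => //; first by rewrite /inA jx.
  by rewrite -inA_opp /inA vo kx.
by move: kx; rewrite -jk -(eqP jx) eq_sym -addr_eq0 -mulr2n mulrn_eq0 (eqP jx) (negPf (a_neq0 j)).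
Qed.

Let mark_pos_t x : mark_pos x -> mark_pos (t x).
Proof.
move=> /existsP[j /eqP jx]; have tx : v (t x) = a j.+1.
  by rewrite /a permXS; apply: cycle_vec_commute.
have [j1|] := ltnP j.+1 p; first by apply/existsP; exists (Ordinal j1); rewrite tx.
move=> j1; have {}j1 : j.+1 = p by apply/eqP; rewrite eqn_leq ltn_ord.
by apply/existsP; exists (Ordinal p_gt0); apply/eqP; rewrite tx j1; exact: (aDp 0).
Qed.

Let mark_pos_fix w x : fixes v w -> mark_pos (w x) = mark_pos x.
Proof. by move=> fw; apply: eq_existsb => j; rewrite (fixesP _ _ fw). Qed.

Let mark_posU x : (x \in U) = mark_pos x || mark_pos (opp_pt x).
Proof.
rewrite inE; apply/existsP/orP => [[j /orP[]jx]|[]/existsP[j jx]].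
- by left; apply/existsP; exists j.
- by right; apply/existsP; exists j; rewrite vo eqr_oppLR.
- by exists j; rewrite /inA jx.
by exists j; rewrite -inA_opp /inA jx.
Qed.

Let mark_pos_kappa x : mark_pos x -> mark_pos (kappa x).
Proof.
move=> px; rewrite kappaE mark_posU px /=.
by case: ifP => _; rewrite mark_pos_t ?mark_pos_fix.
Qed.

Let merged_selfneg_U x : x \in U -> ~~ selfneg g' x.
Proof.
have mg' y : mark_pos y -> mark_pos (g' y).
  by move=> py; rewrite /merged permM mark_pos_kappa ?mark_pos_fix.
have mX k y : mark_pos y -> mark_pos ((g' ^+ k) y).
  by move=> py; elim: k => [|k IHk]; rewrite ?perm1 // permXS mg'.
have nopp y : mark_pos y -> ~~ selfneg g' y.
  move=> py; apply/negP => /porbitP[k e]; have := mark_pos_opp py.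
  by rewrite e mX.
by rewrite mark_posU => /orP[]/nopp //; rewrite selfneg_opp ?merged_opp.
Qed.

Lemma merged_cox_type : cox_type g'.
Proof.
have nU x : selfneg g x -> x \notin U.
  move=> sx; apply/negP => /UP[j _]; rewrite /inA.
  rewrite (fixes_selfneg vo vg sx) eq_sym (negPf (a_neq0 j)) /=.
  by rewrite eq_sym oppr_eq0 (negPf (a_neq0 j)).
have sg' x : selfneg g' x = selfneg g x.
  have [xU|nxU] := boolP (x \in U); last by rewrite /selfneg porbit_out.
  by rewrite (negPf (merged_selfneg_U xU)); apply/esym/negP => /nU; rewrite xU.
case: tg => [ng|[z [y [gz yz ynz sy sP]]]]; first by left=> x; rewrite sg'.
have sz : selfneg g z by rewrite /selfneg -gz -{1}(expg1 g) mem_porbit.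
right; exists z, y; split; rewrite ?sg' //.
  by have := @g'_out z 1 (nU _ sz); rewrite !expg1 gz.
by move=> x; rewrite sg' (porbit_out (nU _ sy)); apply: sP.
Qed.

End Merge.

End Merging.

(** * Odd primes *)

Section Regular.

Variable n : nat.
Local Notation pt := (signed_pt n).
Local Notation sperm := (signed_perm n).
Local Notation opp_perm := (opp_perm n).
Local Notation opp_ptK := (@opp_ptK n).
Implicit Types (a b x y : pt) (f v : pt -> int) (g h w s t : sperm).
Hypothesis n_gt1 : (1 < n)%N.
Local Notation W := (weylD n).

Lemma parabolic_cycle_vecE (K : {set sperm}) g w : K \subset gensD n -> is_coxeter_elt K g ->
  w \in W -> (w \in <<K>>) = fixes (cycle_vec g) w.
Proof.
move=> sK gK wW; have gW := subsetP (gen_sub_weylD sK) _ (coxeter_gen gK).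
have [cg _] := weylD_even gW; apply/idP/idP => [|fw].
  exact: (coxeter_fixes sK gK (odd_cycle_vec _) (fixes_cycle_vec cg)).
rewrite parabolicE //; apply: fixes_of_cycle_vec fw => //; first exact: odd_par_vec.
by rewrite -parabolicE // coxeter_gen.
Qed.

(** Cauchy's theorem gives t of order p modulo W_K. As [g ^ t] has the same fixed vectors as g, it
    is conjugate to g by an element h that fixes them, thus h lies in W_K; then [t * h] represents
    the same class and commutes with g. *)
Lemma normalizer_commuting (K : {set sperm}) g (p : nat) : prime p -> K \subset gensD n ->
  is_coxeter_elt K g -> p %| #|'N_W(<<K>>) : <<K>>| ->
  exists t, [/\ t \in W, commute g t, t \notin <<K>> & t ^+ p \in <<K>>].
Proof.
move=> p_pr sK gK; set G := <<K>>%G; have sGW : G \subset W := gen_sub_weylD sK.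
have nGN : 'N_W(G) \subset 'N(G) := subsetIr _ _.
rewrite -card_quotient // => /(Cauchy p_pr)[xb xbN ob].
have /morphimP[t tN /setIP[tW _] exb] := xbN.
have gW := subsetP sGW _ (coxeter_gen gK); have [cg _] := weylD_even gW.
have [ct _] := weylD_even tW; have cgt : g ^ t \in 'C[opp_perm] by rewrite groupJ.
have gG : g \in G := coxeter_gen gK.
have gtG : g ^ t \in G by rewrite memJ_norm.
have tg := coxeter_elt_cox_type n_gt1 sK gK.
have [||h hW [gth fh]] := cox_type_conj cgt cg _ tg.
- exact: cox_type_conjg.
- apply/andP; split; last by rewrite -(parabolic_cycle_vecE sK gK) // (subsetP sGW).
  apply: (coxeter_conj_fixes sK gK tW (odd_cycle_vec _) (fixes_cycle_vec cgt)).
  by rewrite (normP tN).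
have hG : h \in G.
  rewrite parabolicE //; apply: fixes_of_cycle_vec fh => //; first exact: odd_par_vec.
  by rewrite -(parabolicE sK) // (subsetP sGW).
have hN : h \in 'N(G) := subsetP (normG G) _ hG.
have eth : coset G (t * h) = xb by rewrite morphM //= (coset_id hG) mulg1 exb.
have thN : t * h \in 'N(G) by rewrite groupM.
exists (t * h); split.
- by rewrite groupM.
- by apply/commgP/conjg_fixP; rewrite conjgM.
- apply: contraTN (prime_gt1 p_pr) => thG.
  by rewrite -ob -eth (coset_id thG) order1.
by apply: coset_idr; rewrite ?groupX // morphX //= eth -ob expg_order.
Qed.

Lemma odd_permX w k : odd_perm (w ^+ k) = odd k && odd_perm w.
Proof.
by elim: k => [|k IHk]; rewrite ?odd_perm1 // expgS odd_permM IHk /=; case: odd; case: odd_perm.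
Qed.

Lemma odd_order_even_perm w : odd #[w] -> ~~ odd_perm w.
Proof. by move=> ow; have := odd_permX w #[w]; rewrite expg_order odd_perm1 ow /= => <-. Qed.

Lemma enlarge_parabolic (K : {set sperm}) g (p : nat) : prime p -> odd p -> K \subset gensD n ->
  is_coxeter_elt K g -> p %| #|'N_W(<<K>>) : <<K>>| ->
  exists g', [/\ g' \in W, cox_type g', g'.`_p^' = g.`_p^',
    {in <<K>>, forall w, fixes (cycle_vec g') w} & g' \notin <<K>>].
Proof.
move=> p_pr p_odd sK gK pK; have [t [tW gt ntK tpK]] := normalizer_commuting p_pr sK gK pK.
have gW := subsetP (gen_sub_weylD sK) _ (coxeter_gen gK).
have [cg eg] := weylD_even gW; have [ct _] := weylD_even tW.
have vtp : fixes (cycle_vec g) (t ^+ p) by rewrite -(parabolic_cycle_vecE sK gK) //; exact: groupX.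
have : ~~ fixes (cycle_vec g) t by rewrite -(parabolic_cycle_vecE sK gK).
case/forallPn=> x0 vtx0; have tg := coxeter_elt_cox_type n_gt1 sK gK.
have g'W : merged p g t x0 \in W.
  apply/weylDP; split; first exact: merged_opp.
  (* A power of the even g is even, and the merger has p-power order, which is odd, so it is even as
     well. *)
  rewrite odd_permM odd_permX (negPf eg) andbF.
  apply: odd_order_even_perm; apply: (@dvdn_odd _ (p ^ logn p #[merger p g t x0])).
    by rewrite -p_part part_pnat_id //; apply: merger_p_elt.
  by rewrite oddX p_odd orbT.
exists (merged p g t x0); split=> //.
- exact: merged_cox_type.
- exact: merged_p'part.
- apply: (coxeter_fixes sK gK (odd_cycle_vec _)); apply: (merged_fixes p_pr p_odd cg ct gt vtp vtx0).
  exact: fixes_cycle_vec (merged_opp p_pr p_odd cg ct gt vtp vtx0).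
by rewrite (parabolic_cycle_vecE sK gK) //; apply: merged_not_fixes.
Qed.

Lemma mark_coxeter (J K : {set sperm}) g : J \subset gensD n -> K \subset gensD n ->
  is_coxeter_elt K g -> mark J K = #|fixed_cosets W <<J>> <[g]>|.
Proof.
move=> sJ sK gK; have sJW := gen_sub_weylD sJ; apply: eq_card => H.
rewrite -[LHS]/(H \in fixed_cosets W <<J>>%G <<K>>).
apply/(fixed_cosetsP sJW)/(fixed_cosetsP sJW) => -[x [xW sx ->]]; exists x; split=> //;
  by move: sx; rewrite cycle_subG -(coxeter_conj_sub sJ sK gK xW).
Qed.

Lemma mark_p'part_conj (J K L : {set sperm}) g h (p : nat) :
  J \subset gensD n -> K \subset gensD n -> L \subset gensD n ->
  is_coxeter_elt K g -> is_coxeter_elt L h -> h.`_p^' \in g.`_p^' ^: W ->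
  mark J K = mark J L %[mod p].
Proof.
move=> sJ sK sL gK hL /imsetP[t tW eh]; have sJW := gen_sub_weylD sJ.
have gW := subsetP (gen_sub_weylD sK) _ (coxeter_gen gK).
have hW := subsetP (gen_sub_weylD sL) _ (coxeter_gen hL).
rewrite (mark_coxeter sJ sK gK) (mark_coxeter sJ sL hL).
rewrite (fixed_cosets_p'part sJW p gW) (fixed_cosets_p'part sJW p hW) eh.
by rewrite cycleJ card_fixed_cosetsJ.
Qed.

Lemma index_dvd_mark (J K : {set sperm}) : J \subset gensD n ->
  #|'N_W(<<J>>) : <<J>>| %| mark J K.
Proof. by move=> sJ; apply: (index_dvd_fixed_cosets (gen_sub_weylD sJ)). Qed.

Lemma mark_self (J : {set sperm}) : mark J J = #|'N_W(<<J>>) : <<J>>|.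
Proof. exact: fixed_cosets_self. Qed.

Lemma mark_neq0 (J K : {set sperm}) : J \subset gensD n -> mark J K != 0%N ->
  exists2 x, x \in W & <<K>> \subset <<J>> :^ x.
Proof. by move=> sJ; apply: (fixed_cosets_neq0 (gen_sub_weylD sJ)). Qed.

(** * Class representatives and the decomposition matrix at odd primes *)

Section Representatives.

Variables (E : {set {set sperm}}) (c : {set sperm} -> sperm).
Hypothesis E_reps : is_subset_reps E.
Hypothesis c_cox : forall J : {set sperm}, J \subset gensD n -> is_coxeter_elt J (c J).

Let conj_equiv : {in powerset (gensD n) & &,
  equivalence_rel (fun J K : {set sperm} => K \in J :^: W)}.
Proof.
move=> A B C _ _ _; split; first by apply/imsetP; exists 1; rewrite ?conjsg1.
case/imsetP=> t tW ->; apply/imsetP/imsetP => -[r rW ->].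
  by exists (t^-1 * r); rewrite ?groupM ?groupV // -conjsgM mulKVg.
by exists (t * r); rewrite ?groupM // conjsgM.
Qed.

Lemma reps_sub J : J \in E -> J \subset gensD n.
Proof. by move/(subsetP (transversal_sub E_reps)); rewrite inE. Qed.

Lemma reps_exists (J : {set sperm}) : J \subset gensD n ->
  exists2 J', J' \in E & exists2 x, x \in W & J' = J :^ x.
Proof.
move=> sJ; set P := equivalence_partition (fun J K => K \in J :^: weylD n) (powerset (gensD n)).
have partP : partition P (powerset (gensD n)) := equivalence_partitionP conj_equiv.
have Jin : J \in powerset (gensD n) by rewrite inE.
have BP : pblock P J \in P by rewrite pblock_mem // (cover_partition partP).
have rE := repr_mem_transversal E_reps set0 BP.
have rB := repr_mem_pblock E_reps set0 BP.
exists (transversal_repr set0 E (pblock P J)) => //.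
move: rB; rewrite pblock_equivalence_partition //; last first.
  by rewrite (subsetP (transversal_sub E_reps)).
by case/imsetP=> x xW ex; exists x.
Qed.

Lemma reps_inj J K (x : sperm) : J \in E -> K \in E -> x \in W -> K = J :^ x -> J = K.
Proof.
move=> JE KE xW eK; set P := equivalence_partition (fun J K => K \in J :^: weylD n) (powerset (gensD n)).
have partP : partition P (powerset (gensD n)) := equivalence_partitionP conj_equiv.
apply: (pblock_inj E_reps JE KE); apply: same_pblock; first by case/and3P: partP.
rewrite pblock_equivalence_partition ?inE ?reps_sub //.
by apply/imsetP; exists x^-1; rewrite ?groupV // eK conjsgK.
Qed.

Lemma exists_p_regular (p : nat) (K0 : {set sperm}) : prime p -> odd p -> K0 \in E ->
  exists K, [/\ K \in E, (c K).`_p^' \in (c K0).`_p^' ^: W &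
    ~~ (p %| #|'N_W(<<K>>) : <<K>>|)].
Proof.
move=> p_pr p_odd K0E; pose Q K := (K \in E) && ((c K).`_p^' \in (c K0).`_p^' ^: W).
have QK0 : Q K0 by rewrite /Q K0E class_refl.
case: (@arg_maxnP _ K0 Q (fun K => #|<<K>>|) QK0) => K /andP[KE KK0] Kmax.
exists K; split=> //; apply/negP => pK; have sK := reps_sub KE; have cK := c_cox sK.
have [g' [g'W tg' g'p fg' g'nK]] := enlarge_parabolic p_pr p_odd sK cK pK.
have [L [x [sL xW Lstab Lcox]]] := cox_type_parabolic n_gt1 g'W tg'.
have [M ME [y yW eM]] := reps_exists sL; have sM := reps_sub ME.
have [|t tW et] := coxeter_elt_conj n_gt1 sM sL (c_cox sM) (c_cox sL) yW.
  by rewrite eM genJ.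
have [r rW er] := Lcox _ (c_cox sL).
have QM : Q M.
  rewrite /Q ME; have -> : c M = g' ^ (r^-1 * t) by rewrite conjgM -er conjgK et.
  by rewrite consttJ g'p -(class_eqP KK0) memJ_class // groupM ?groupV.
have /= := Kmax _ QM; rewrite eM genJ cardJg leqNgt => /negP; apply.
rewrite -(cardJg <<L>> x); apply: proper_card; apply/properP; split.
  apply/subsetP => w wK; rewrite Lstab ?fg' //.
  exact: subsetP (gen_sub_weylD sK) _ wK.
exists g' => //; rewrite Lstab //; apply: fixes_cycle_vec.
exact: (weylD_even g'W).1.
Qed.

Lemma decomp_odd (p : nat) K L : prime p -> odd p -> K \in E -> L \in nonzero_rows p E ->
  decomp p E K L = 1%N <-> (c L).`_p^' \in (c K).`_p^' ^: W.
Proof.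
move=> p_pr p_odd KE /setIdP[LE /exists_inP[M ME nzLM]].
have [sK sL] := (reps_sub KE, reps_sub LE).
have -> : decomp p E K L = 1%N <-> {in E, forall J, mark J K = mark J L %[mod p]}.
  rewrite /decomp; case: ifPn => [/forall_inP eqKL|/forall_inPn[J JE neq]]; split=> //.
    by move=> _ J /eqKL/eqP.
  by move/(_ J JE) => e; rewrite e eqxx in neq.
split=> [eqKL | conjKL]; last first.
  move=> J JE; exact: mark_p'part_conj (reps_sub JE) sK sL (c_cox sK) (c_cox sL) conjKL.
have [R [RE RK pR]] := exists_p_regular p_pr p_odd KE; have sR := reps_sub RE.
have eqRL : {in E, forall J, mark J R = mark J L %[mod p]}.
  move=> J JE; rewrite -eqKL //; apply/esym.
  exact: mark_p'part_conj (reps_sub JE) sK sR (c_cox sK) (c_cox sR) RK.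
have nz J K' : mark J K' != 0%N %[mod p] -> mark J K' != 0%N.
  by apply: contraNneq => ->.
(* As row L has an entry prime to p and its diagonal mark divides every entry, the diagonal mark is
   prime to p; equality of columns carries this over to [mark L R]. *)
have [x xW RLx] : exists2 x, x \in W & <<R>> \subset <<L>> :^ x.
  apply: mark_neq0 => //; apply: nz; rewrite eqRL // mark_self mod0n.
  apply: contra nzLM; rewrite mod0n => pL; apply: dvdn_trans pL _.
  exact: index_dvd_mark.
have [y yW LRy] : exists2 y, y \in W & <<L>> \subset <<R>> :^ y.
  by apply: mark_neq0 => //; apply: nz; rewrite -eqRL // mark_self mod0n.
have eRL : <<R>> = <<L>> :^ x.
  by apply/eqP; rewrite eqEcard RLx cardJg -(cardJg <<R>> y) subset_leq_card.
have [t tW et] := coxeter_elt_conj n_gt1 sR sL (c_cox sR) (c_cox sL) xW eRL.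
case/imsetP: RK => r rW; rewrite -et consttJ => er.
apply/imsetP; exists (r * t^-1); first by rewrite groupM ?groupV.
by rewrite conjgM -er conjgK.
Qed.

End Representatives.

End Regular.

(** * The prime 2 *)

Section SignChanges.

Variable n : nat.
Local Notation pt := (signed_pt n).
Local Notation sperm := (signed_perm n).
Local Notation opp_perm := (opp_perm n).
Local Notation opp_ptK := (@opp_ptK n).
Implicit Types (a b x y : pt) (f v : pt -> int) (g h w s t : sperm).
Local Notation W := (weylD n).
Implicit Types B : {set 'I_n}.

Lemma neg_fun_inv B : involutive (fun x : pt => if x.1 \in B then opp_pt x else x).
Proof. by move=> x /=; case: (boolP (x.1 \in B)) => xB; rewrite /= ?xB ?opp_ptK ?(negPf xB). Qed.

Definition neg_set B : sperm := perm (inv_inj (neg_fun_inv B)).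

Lemma neg_setE B x : neg_set B x = if x.1 \in B then opp_pt x else x.
Proof. by rewrite permE. Qed.

Lemma neg_setK B : neg_set B * neg_set B = 1.
Proof. by apply/permP => x; rewrite permM perm1 !permE; apply: neg_fun_inv. Qed.

Lemma neg_set_opp B : neg_set B \in 'C[opp_perm].
Proof. by apply/cent_oppP => x; rewrite !neg_setE /=; case: ifP. Qed.

Lemma odd_neg_set B : odd_perm (neg_set B) = odd #|B|.
Proof.
have [k] := ubnP #|B|; elim: k B => // k IHk B; rewrite ltnS => leBk.
have [->|[i iB]] := set_0Vmem B.
  rewrite cards0 (_ : neg_set _ = 1) ?odd_perm1 //.
  by apply/permP => x; rewrite neg_setE inE perm1.
have -> : neg_set B = tperm ((i, false) : pt) (i, true) * neg_set (B :\ i).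
  apply/permP => x; rewrite permM !neg_setE.
  case: tpermP => [->|->|] /=; rewrite ?setD11 ?iB // in_setD1.
  case: x => j e; have [->|//] := eqVneq j i.
  by case: e => [_ []|[]].
rewrite odd_permM odd_tperm IHk; last by move: leBk; rewrite (cardsD1 i) iB.
by rewrite xpair_eqE andbF (cardsD1 i B) iB oddD.
Qed.

Lemma neg_set_weylD B : ~~ odd #|B| -> neg_set B \in W.
Proof. by move=> eB; apply/weylDP; rewrite neg_set_opp odd_neg_set. Qed.

Lemma opp_perm_neg_set : opp_perm = neg_set setT.
Proof. by apply/permP => x; rewrite opp_permE neg_setE inE. Qed.

(** Whatever fixes [par_vec J] also fixes its composition with [phi], that is, its image under z. *)
Lemma normalizes_parabolic (J : {set sperm}) z (phi : int -> int) : J \subset gensD n ->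
  z \in W -> (forall x, par_vec J (z x) = phi (par_vec J x)) -> z \in 'N(<<J>>).
Proof.
move=> sJ zW vz; rewrite inE; apply/subsetP => _ /imsetP[w wJ ->].
have wW := subsetP (gen_sub_weylD sJ) _ wJ.
rewrite parabolicE ?groupJ // fixes_conj; apply/fixesP => x /=.
by rewrite !vz; move: wJ; rewrite parabolicE // => /fixesP->.
Qed.

Lemma par_vec_neq0 (J : {set sperm}) : J \subset gensD n -> J != gensD n ->
  exists i : 'I_n, par_vec J (i, false) != 0%R.
Proof.
move=> sJ; rewrite eqEsubset sJ => /subsetPn[s /gensDP[a [b [sab ->]]] sJ'].
have : par_vec J a != 0%R \/ par_vec J b != 0%R.
  apply/orP; rewrite -negb_and; apply: contra sJ' => /andP[/eqP va /eqP vb].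
  by rewrite -par_vec_eq // va vb.
have nz x : par_vec J x != 0%R -> exists i : 'I_n, par_vec J (i, false) != 0%R.
  case: x => i [] vi; exists i => //.
  by rewrite -[(i, false)]/(opp_pt (i, true)) odd_par_vec oppr_eq0.
by case=> /nz.
Qed.

Lemma index_even (gT : finGroupType) (V G : {group gT}) (z : gT) :
  z \in 'N_V(G) -> z \notin G -> z * z = 1 -> 2 %| #|'N_V(G) : G|.
Proof.
move=> zN nzG zz; have nGN : 'N_V(G) \subset 'N(G) := subsetIr _ _.
have zNG := subsetP nGN _ zN.
rewrite -card_quotient // -(_ : #[coset G z] = 2).
  by apply: order_dvdG; apply: mem_quotient.
apply: nt_prime_order => //; first by rewrite -morphX // expgS expg1 zz morph1.
by apply: contra nzG => /eqP; apply: coset_idr.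
Qed.

(* Up to a zero coordinate, B consists of the coordinates of the vector of J whose
   absolute value satisfies some Q. Thus [neg_set B] acts on this vector through its
   values, hence normalizes its stabilizer. *)
Lemma exists_normalizing_neg (J : {set sperm}) : J \subset gensD n -> J != gensD n ->
  ~~ odd n \/ (exists i j : 'I_n, `|par_vec J (i, false)|%N != `|par_vec J (j, false)|%N) ->
  exists B, [/\ ~~ odd #|B|, neg_set B \in 'N(<<J>>), neg_set B \notin <<J>> & B != set0].
Proof.
move=> sJ nJS nconst; set v := par_vec J; have vo : odd_fun v by apply: odd_par_vec.
suff [B [Q [eB [i iB vi] BQ]]] : exists B (Q : nat -> bool), [/\ ~~ odd #|B|,
    exists2 i, i \in B & v (i, false) != 0%R &
    forall i : 'I_n, v (i, false) != 0%R -> (i \in B) = Q `|v (i, false)|%N].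
  have zW := neg_set_weylD eB; exists B; split=> //; last by apply/set0Pn; exists i.
    apply: (@normalizes_parabolic J _ (fun m : int => if Q `|m|%N then (- m)%R else m)) => // x.
    rewrite -/v neg_setE; have [v0|nv0] := eqVneq (v x) 0%R.
      by rewrite v0 oppr0 if_same; case: ifP => // _; rewrite vo v0 oppr0.
    have -> : (x.1 \in B) = Q `|v x|%N.
      case: x nv0 => j [] /=; last exact: BQ.
      by rewrite -[(j, true)]/(opp_pt (j, false)) vo oppr_eq0 abszN => /BQ.
    by case: ifP.
  rewrite parabolicE //; apply/negP => /fixesP/(_ (i, false)); rewrite -/v neg_setE iB vo.
  by move/eqP; rewrite eq_sym -addr_eq0 -mulr2n mulrn_eq0 (negPf vi).
have [i0 vi0] := par_vec_neq0 sJ nJS; rewrite -/v in vi0 nconst.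
pose cls m := [set i | `|v (i, false)|%N == m].
have clsP i m : (i \in cls m) = (`|v (i, false)|%N == m) by rewrite inE.
pose m0 := `|v (i0, false)|%N; have i0m0 : i0 \in cls m0 by rewrite clsP.
have [om0|em0] := boolP (odd #|cls m0|); last first.
  by exists (cls m0), (pred1 m0); split=> //; exists i0.
(* If this odd class were everything, n would be odd and the absolute value constant, against both
   alternatives of [nconst]. *)
have [i1 ni1] : exists i1, i1 \notin cls m0.
  apply/existsP; rewrite -negb_forall; apply/negP => /forallP all0.
  case: nconst => [|[i [j]]]; last first.
    by have := all0 i; have := all0 j; rewrite !clsP => /eqP-> /eqP->; rewrite eqxx.
  move: om0; rewrite (_ : cls m0 = setT) ?cardsT ?card_ord => [->|] //.
  by apply/setP => i; rewrite all0 inE.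
(* The odd size of the first class is repaired by adding a zero coordinate, whose sign is invisible,
   by using an even class instead, or by joining two odd classes. *)
pose m1 := `|v (i1, false)|%N; have m10 : m1 != m0 by rewrite -clsP.
have [v10|v1] := eqVneq (v (i1, false)) 0%R.
  exists (i1 |: cls m0), (pred1 m0); split; first by rewrite cardsU1 ni1 /= om0.
    by exists i0; rewrite ?inE ?eqxx ?orbT.
  move=> i vi; rewrite in_setU1 clsP /=; case: eqP => // ei.
  by rewrite ei v10 eqxx in vi.
have [om1|em1] := boolP (odd #|cls m1|); last first.
  by exists (cls m1), (pred1 m1); split=> //; exists i1; rewrite ?clsP.
exists (cls m0 :|: cls m1), (pred2 m0 m1); split.
- rewrite cardsU (_ : _ :&: _ = set0) ?cards0 ?subn0 ?oddD ?om0 ?om1 //.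
  apply/setP => i; rewrite !inE; apply/negbTE/andP => -[/eqP-> /eqP].
  by move/esym/eqP; rewrite (negPf m10).
- by exists i0; rewrite ?inE ?eqxx.
by move=> i _; rewrite in_setU !clsP.
Qed.

Lemma mark_even (J K : {set sperm}) : J \subset gensD n -> J != gensD n ->
  ~~ odd n \/ (exists i j : 'I_n, `|par_vec J (i, false)|%N != `|par_vec J (j, false)|%N) ->
  ~~ odd (mark J K).
Proof.
move=> sJ nJ nconst; have [B [eB nB nBJ _]] := exists_normalizing_neg sJ nJ nconst.
rewrite -dvdn2; apply: dvdn_trans (index_dvd_mark K sJ).
by apply: (index_even _ nBJ (neg_setK B)); rewrite inE neg_set_weylD.
Qed.

Lemma mark_gensD (K : {set sperm}) : K \subset gensD n -> mark (gensD n) K = 1%N.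
Proof.
move=> sK; have := card_transporter (subxx W) <<K>>.
have -> : transporter W W <<K>> = W.
  apply/setP => x; rewrite inE; case: (boolP (x \in W)) => //= xW.
  by rewrite conjGid // gen_sub_weylD.
move/eqP; rewrite -{1}[#|W|]mul1n eqn_pmul2r ?cardG_gt0 // => /eqP e.
by rewrite [RHS]e.
Qed.

End SignChanges.

(** * The rows of S and S' modulo 2 *)

Section ModTwoMarks.

Variable n : nat.
Local Notation pt := (signed_pt n).
Local Notation sperm := (signed_perm n).
Local Notation opp_perm := (opp_perm n).
Local Notation opp_ptK := (@opp_ptK n).
Implicit Types (a b x y : pt) (f v : pt -> int) (g h w s t : sperm).
Local Notation W := (weylD n).
Local Notation pos_vec := (@pos_vec n).
Hypothesis n_gt1 : (1 < n)%N.

Lemma simple_fixerE f s : (s \in simple_fixer f) = (s \in gensD n) && fixes f s.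
Proof. by rewrite inE. Qed.

Lemma pos_vec_odd : odd_fun pos_vec.
Proof. exact: odd_vec. Qed.

Lemma pos_vec_dominant : dominant pos_vec.
Proof. by case=> i c [j []] // _; rewrite /pos_vec /vec /=; case: c. Qed.

Lemma gensA_fixer : gensA n = simple_fixer pos_vec.
Proof.
apply/setP => s; rewrite inE; apply/idP/andP => [sA | [sS fs]].
  split; first exact: subsetP (gensA_sub n) s sA.
  case/gensAP: sA => a [b [sab na ->]]; rewrite refl_fixes ?simple_neq //; last exact: pos_vec_odd.
  by case/andP: sab => nb _; rewrite /pos_vec /vec (negPf na) (negPf nb).
case/gensDP: sS fs => a [b [sab ->]]; rewrite refl_fixes ?simple_neq //; last exact: pos_vec_odd.
move=> ab; apply/gensAP; exists a, b; split=> //; move: ab; case/andP: sab => nb _.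
by rewrite /pos_vec /vec (negPf nb); case: (a.2).
Qed.

Lemma mem_gensA w : w \in W -> (w \in <<gensA n>>) = fixes pos_vec w.
Proof.
move=> wW; rewrite gensA_fixer dominant_fixerE //; first exact: pos_vec_odd.
exact: pos_vec_dominant.
Qed.

Lemma fixes_gensA_const f : odd_fun f -> {in gensA n, forall s, fixes f s} ->
  forall i : 'I_n, f (i, false) = f (Ordinal (ltnW n_gt1), false).
Proof.
move=> fo fA [i lt_i]; elim: i lt_i => [|i IHi] lt_i.
  by congr (f (_, _)); apply: val_inj.
rewrite -(IHi (ltnW lt_i)); apply/esym/eqP.
have sab : simple ((Ordinal (ltnW lt_i), false) : pt) (Ordinal lt_i, false) by rewrite /simple /=.
by rewrite -refl_fixes ?simple_neq // fA //; apply/gensAP; do 2!eexists; split; first exact: sab.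
Qed.

Let i0 : 'I_n := Ordinal (ltnW n_gt1).
Let i1 : 'I_n := Ordinal n_gt1.

Let u := refl ((i0, true) : pt) (i1, false).
Let s1 := refl ((i0, false) : pt) (i1, false).
Let uS : u \in gensD n.
Proof. by apply/gensDP; exists (i0, true), (i1, false). Qed.
Let s1S : s1 \in gensD n.
Proof. by apply/gensDP; exists (i0, false), (i1, false). Qed.

(** This is the diagram automorphism of D_n exchanging u and s1. It changes n - 1 signs, so for n
    odd it is conjugation by an element of W. *)
Lemma neg_tail_gensD s : s \in gensD n -> s ^ neg_set (~: [set i0]) \in gensD n.
Proof.
set z := neg_set _ => sS; have cz : z \in 'C[opp_perm] := neg_set_opp _.
have z0 e : z (i0, e) = (i0, e) by rewrite neg_setE !inE eqxx.
have zpos x : (0 < x.1)%N -> z x = opp_pt x.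
  by move=> x_gt0; rewrite neg_setE !inE; case: eqP => // e; rewrite e in x_gt0.
have i01 : i0 != i1 by [].
case/gensDP: (sS) => a [b [sab es]]; case: (simple_cases (erefl : i0 = 0%N :> nat) (erefl : i1 = 1%N :> nat) sab).
- by rewrite -es => ->; rewrite refl_conj // z0 zpos // reflC //.
- by rewrite -es => ->; rewrite refl_conj // z0 zpos // reflC //.
case/andP=> na a_gt0; rewrite es refl_conj // !zpos //; last first.
  by case/andP: sab => _; rewrite (negPf na) => /eqP->.
by rewrite -reflC ?simple_neq // -es.
Qed.

(** A dominant vector of constant absolute value m is m times (1, 1, ..., 1) or (-1, 1, ..., 1). The
    stabilizers are W_S' and its image under the diagram automorphism, which is inner for n odd. *)
Lemma const_par_vec_conj (J : {set sperm}) (m : nat) : odd n -> J \subset gensD n -> m != 0%N ->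
  (forall i : 'I_n, `|par_vec J (i, false)|%N = m) ->
  exists2 x, x \in W & gensA n = J :^ x.
Proof.
move=> n_odd sJ m0 Jm; set v := par_vec J; have vo : odd_fun v by apply: odd_par_vec.
have vd : dominant v := @par_vec_dominant _ J.
have vpos (i : 'I_n) : (0 < i)%N -> v (i, false) = m.
  move=> i_gt0; have le_v e := dominant_le (j := i0) e vo vd i_gt0.
  have := lerD (le_v false) (le_v true).
  rewrite -[(i0, true)]/(opp_pt (i0, false)) vo subrr -mulr2n pmulrn_lge0 // => vi.
  by rewrite -(Jm i) gez0_abs.
suff [z [k [zW k0 zS zz vz]]] : exists z (k : int), [/\ z \in W, k != 0%R,
    {in gensD n, forall s, s ^ z \in gensD n}, z * z = 1 &
    forall x, v x = (k * pos_vec (z x))%R].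
  exists z => //; have zV : z^-1 = z by apply/(mulgI z); rewrite mulgV.
  have Jv : J = simple_fixer v by rewrite simple_fixer_par_vec.
  apply/setP => s; rewrite gensA_fixer mem_conjg zV Jv !simple_fixerE fixes_conj.
  have -> : (s ^ z \in gensD n) = (s \in gensD n).
    by apply/idP/idP => /zS //; rewrite -conjgM zz conjg1.
  congr (_ && _); apply: eq_forallb => x /=.
  have zzx y : z (z y) = y by rewrite -permM zz perm1.
  by rewrite !vz !zzx (inj_eq (mulfI _)).
have vneg (z : sperm) (k : int) : z \in 'C[opp_perm] ->
   (forall i : 'I_n, v (i, false) = (k * pos_vec (z (i, false)))%R) ->
   forall x, v x = (k * pos_vec (z x))%R.
  move=> cz vz [i []] //.
  by rewrite -[(i, true)]/(opp_pt (i, false)) perm_opp // vo pos_vec_odd vz mulrN.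
have [v0|v0] := eqVneq (v (i0, false)) m.
  exists (1 : sperm), (Posz m); rewrite group1 mulg1; split=> //; first by move=> s; rewrite conjg1.
  apply: vneg => // i; rewrite perm1 /pos_vec /vec /= mulr1.
  have [i_0|] := posnP i; last exact: vpos.
  by rewrite (_ : i = i0) //; apply: val_inj.
(* Negating all coordinates but 0 turns (1, 1, ..., 1) into (1, -1, ..., -1), and -m times this is
   v. *)
exists (neg_set (~: [set i0])), (- Posz m)%R; split.
- apply: neg_set_weylD; have := cardsC1 i0; rewrite card_ord => ->.
  by move: n_odd; rewrite -{1}(prednK (ltnW n_gt1)).
- by rewrite oppr_eq0.
- by move=> s; apply: neg_tail_gensD.
- exact: neg_setK.
apply: vneg => [|i]; first exact: neg_set_opp.
rewrite neg_setE !inE /pos_vec /vec /=; have [->|ni0] := eqVneq i i0.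
  move: v0 (Jm i0); rewrite -/v mulr1; case: (v (i0, false)) => k /= kv km.
    by rewrite -km eqxx in kv.
  by rewrite NegzE km.
rewrite mulrNN mulr1 vpos // lt0n; apply: contra ni0 => /eqP i_0.
by apply/eqP/val_inj.
Qed.

Lemma gensD_neq_gensA : gensD n != gensA n.
Proof.
apply/eqP => eDA; have := uS; rewrite eDA gensA_fixer simple_fixerE => /andP[_].
by rewrite refl_fixes //; exact: pos_vec_odd.
Qed.

(** The sign change is an involution acting on the cosets fixed by W_K without fixed points: a
    conjugate of W_S' fixes a nowhere zero vector, which a nontrivial sign change cannot do. *)
Lemma mark_gensA_even (K : {set sperm}) B : B != set0 -> ~~ odd #|B| ->
  neg_set B \in 'N(<<K>>) -> ~~ odd (mark (gensA n) K).
Proof.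
move=> /set0Pn[i iB] eB nBK; set z := neg_set B; have zW : z \in W := neg_set_weylD eB.
have sAW : <<gensA n>>%G \subset W := gen_sub_weylD (gensA_sub n).
have z2 : 2.-group <[z]>.
  rewrite /pgroup -orderE; apply: (@pnat_dvd _ 2) => //.
  by rewrite order_dvdn expgS expg1 neg_setK.
have := fixed_cosets_mod sAW z2 _ (_ : <[z]> \subset 'N(<<K>>)).
rewrite !cycle_subG => /(_ zW nBK) e.
suff f0 : fixed_cosets W <<gensA n>> (<<K>> :|: <[z]>) = set0.
  by rewrite f0 cards0 !modn2 in e; case: odd e.
apply/setP => H; rewrite in_set0; apply/negP => /(fixed_cosetsP sAW)[x [xW + _]].
rewrite subUset cycle_subG mem_conjg mem_gensA ?groupJ ?groupV // => /andP[_].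
have [cx _] := weylD_even (groupVr xW).
rewrite fixes_conj => /fixesP/(_ (i, false)) /=; rewrite neg_setE iB perm_opp // pos_vec_odd.
by move/eqP; rewrite eq_sym -addr_eq0 -mulr2n mulrn_eq0 (negPf (pos_vec_neq0 _)).
Qed.

(** The vectors fixed by W_S' form the line of [pos_vec], so an element of the normalizer maps
    [pos_vec] to itself or to its opposite. The latter would put -1 into W, but -1 changes n signs
    and n is odd. *)
Lemma mark_gensA_self : odd n -> mark (gensA n) (gensA n) = 1%N.
Proof.
move=> n_odd; rewrite mark_self; apply/eqP; rewrite indexg_eq1; apply/subsetP => x /setIP[xW xN].
have [cx ex] := weylD_even xW; rewrite mem_gensA //.
have fo : odd_fun (pos_vec \o x) by apply: odd_fun_comp pos_vec_odd cx.
have fA : {in gensA n, forall s, fixes (pos_vec \o x) s}.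
  move=> s sA; rewrite -fixes_conj -mem_gensA; last first.
    by rewrite groupJ // mem_gen // (subsetP (gensA_sub n)).
  by rewrite memJ_norm ?mem_gen.
have fc := fixes_gensA_const fo fA; rewrite -/i0 in fc.
have fE y : pos_vec (x y) = (pos_vec (x (i0, false)) * pos_vec y)%R.
  have fcE (i : 'I_n) : pos_vec (x (i, false)) = pos_vec (x (i0, false)) by exact: fc.
  case: y => i []; last by rewrite fcE {3}/pos_vec /vec /= mulr1.
  by rewrite -[(i, true)]/(opp_pt (i, false)) perm_opp // !pos_vec_odd fcE {3}/pos_vec /vec /= mulrN mulr1.
have [e1|e1] : pos_vec (x (i0, false)) = 1%R \/ pos_vec (x (i0, false)) = (-1)%R.
- by rewrite /pos_vec /vec; case: ifP; [right | left].
- by apply/fixesP => y; rewrite fE e1 mul1r.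
have : ~~ odd_perm (x * opp_perm).
  apply: (fixes_even (f := pos_vec)); first by rewrite groupM // cent1id.
  - exact: pos_vec_odd.
  - by apply/fixesP => y; rewrite permM opp_permE pos_vec_odd fE e1 mulN1r opprK.
  - exact: pos_vec_neq0.
by rewrite odd_permM (negPf ex) opp_perm_neg_set odd_neg_set cardsT card_ord n_odd.
Qed.

Section ModTwo.

Variable E : {set {set sperm}}.
Hypothesis E_reps : is_subset_reps E.

Lemma gensD_reps : gensD n \in E.
Proof.
have [J JE [x xW eJ]] := reps_exists E_reps (subxx _); suff <- : J = gensD n by [].
by apply/eqP; rewrite eqEcard (reps_sub E_reps JE) eJ cardJg /= leqnn.
Qed.

Lemma nonzero_rows2P J : reflect (J \in E /\ exists2 K, K \in E & odd (mark J K))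
  (J \in nonzero_rows 2 E).
Proof.
have oddE K : (mark J K != 0%N %[mod 2]) = odd (mark J K) by rewrite !modn2; case: odd.
apply: (iffP setIdP) => -[JE].
  by case/exists_inP=> K KE; rewrite oddE => mJK; split=> //; exists K.
by case=> K KE mJK; split=> //; apply/exists_inP; exists K; rewrite ?oddE.
Qed.

Lemma decomp2P K L :
  reflect {in E, forall J, odd (mark J K) = odd (mark J L)} (decomp 2 E K L == 1%N).
Proof.
have -> : (decomp 2 E K L == 1%N) = [forall J in E, mark J K == mark J L %[mod 2]].
  by rewrite /decomp; case: ifP.
by apply: (iffP forall_inP) => eqKL J /eqKL; rewrite !modn2; [case: odd; case: odd | move=> ->].
Qed.

Lemma decomp_even : ~~ odd n ->
  nonzero_rows 2 E = [set gensD n] /\ {in E, forall K, decomp 2 E K (gensD n) = 1%N}.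
Proof.
move=> n_even; have mJ J K : J \in E -> J != gensD n -> odd (mark J K) = false.
  by move=> JE nJ; apply/negbTE/mark_even => //; [exact: reps_sub JE | left].
split.
  apply/setP => J; rewrite in_set1; apply/nonzero_rows2P/eqP => [[JE [K _]]|->].
    by apply: contraTeq => nJ; rewrite mJ.
  by split; [| exists (gensD n)]; rewrite ?gensD_reps // mark_gensD.
move=> K KE; apply/eqP/decomp2P => J JE; have [->|nJ] := eqVneq J (gensD n).
  by rewrite !mark_gensD // (reps_sub E_reps KE).
by rewrite !mJ.
Qed.

Lemma decomp_odd_rank : odd n -> gensA n \in E ->
  nonzero_rows 2 E = [set gensA n; gensD n] /\
  {in E & nonzero_rows 2 E, forall K L, decomp 2 E K L = 1%N <->
    (L = gensD n /\ K <> gensA n) \/ (L = gensA n /\ K = gensA n)}.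
Proof.
move=> n_odd AE; have DA := gensD_neq_gensA.
have nconst J : J \in E -> J != gensD n -> J != gensA n ->
    exists i j : 'I_n, `|par_vec J (i, false)|%N != `|par_vec J (j, false)|%N.
  move=> JE nJD nJA; have sJ := reps_sub E_reps JE.
  have [k vk] := par_vec_neq0 sJ nJD.
  have [/forallP eqk|] := boolP [forall i : 'I_n, `|par_vec J (i, false)|%N == `|par_vec J (k, false)|%N].
    have [|i|x xW ex] := @const_par_vec_conj J `|par_vec J (k, false)|%N n_odd sJ.
    - by rewrite absz_eq0.
    - exact/eqP.
    by rewrite (reps_inj E_reps JE AE xW ex) eqxx in nJA.
  by case/forallPn=> i ik; exists i, k.
have mJ J K : J \in E -> J != gensD n -> J != gensA n -> odd (mark J K) = false.
  move=> JE nJD nJA; apply/negbTE/mark_even => //; first exact: reps_sub JE.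
  by right; apply: nconst.
have mA K : K \in E -> odd (mark (gensA n) K) = (K == gensA n).
  move=> KE; have [->|nKA] := eqVneq K (gensA n); first by rewrite mark_gensA_self.
  have [->|nKD] := eqVneq K (gensD n); apply/negbTE.
    (* For K = S every even sign change normalizes W_K = W, and two coordinates give a nontrivial
       one. *)
    have c2 : #|[set i0; i1]| = 2 by rewrite cards2.
    apply: (@mark_gensA_even _ [set i0; i1]); rewrite ?c2 //; first by rewrite -card_gt0 c2.
    by apply: (subsetP (normG W)); apply: neg_set_weylD; rewrite c2.
  have [B [eB nB _ B0]] := exists_normalizing_neg (reps_sub E_reps KE) nKD (or_intror (nconst K KE nKD nKA)).
  exact: mark_gensA_even B0 eB nB.
have rows : nonzero_rows 2 E = [set gensA n; gensD n].
  apply/setP => J; rewrite in_set2; apply/nonzero_rows2P/orP => [[JE [K _]]|].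
    case: eqP => [->|/eqP nJA]; first by left.
    by case: eqP => [->|/eqP nJD]; [right | rewrite mJ].
  case=> /eqP->; split; rewrite ?gensD_reps //.
    by exists (gensA n); rewrite ?mark_gensA_self.
  by exists (gensD n); rewrite ?gensD_reps // mark_gensD.
split=> // K L KE LF; have /nonzero_rows2P[LE _] := LF.
(* Modulo 2 the row of S is constant 1, the row of S' is the indicator of S', and all other rows
   vanish, so only the row of S' separates columns. *)
have -> : decomp 2 E K L = 1%N <-> (K == gensA n) = (L == gensA n).
  split=> [/eqP/decomp2P/(_ _ AE)|eKL]; first by rewrite !mA.
  apply/eqP/decomp2P => J JE; have [->|nJA] := eqVneq J (gensA n); first by rewrite !mA.
  have [->|nJD] := eqVneq J (gensD n); last by rewrite !mJ.
  by rewrite !mark_gensD // (reps_sub E_reps).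
move: LF; rewrite rows => /set2P[]->.
  rewrite eqxx; split=> [/eqP->|[[e]|[_ ->]]]; [by right | by rewrite e eqxx in DA | exact: eqxx].
rewrite (negPf DA); split=> [/negbT/eqP|[[_ /eqP/negPf]|[e]]] //; first by left.
by rewrite e eqxx in DA.
Qed.

End ModTwo.

End ModTwoMarks.

Theorem theorem8 (n p : nat) (E : {set {set signed_perm n}})
    (c : {set signed_perm n} -> signed_perm n)
    (n_ge4 : 4 <= n) (p_prime : prime p)
    (E_reps : is_subset_reps E)
    (c_cox : forall J : {set signed_perm n},
       J \subset gensD n -> is_coxeter_elt J (c J)) :
  [/\ p <> 2 ->
        forall K L : {set signed_perm n}, K \in E -> L \in nonzero_rows p E ->
        (decomp p E K L = 1%N <-> (c L).`_p^' \in (c K).`_p^' ^: weylD n),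
      p = 2 -> ~~ odd n ->
        nonzero_rows p E = [set gensD n] /\
        (forall K : {set signed_perm n}, K \in E -> decomp p E K (gensD n) = 1%N)
    & p = 2 -> odd n -> gensA n \in E ->
        nonzero_rows p E = [set gensA n; gensD n] /\
        (forall K L : {set signed_perm n}, K \in E -> L \in nonzero_rows p E ->
         (decomp p E K L = 1%N <->
            (L = gensD n /\ K <> gensA n) \/ (L = gensA n /\ K = gensA n)))].
Proof.
have n_gt1 : (1 < n)%N by apply: leq_trans n_ge4.
split=> [p2 K L KE LF | -> n_even | -> n_odd AE].
- have [|p_odd] := even_prime p_prime; first by move/p2.
  exact: decomp_odd.
- exact: decomp_even.
exact: decomp_odd_rank.
Qed.
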